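(* Let $\mu$ be the Borel probability measure on $\Omega$ defined in the context, and let $\mathbb{P}_\mu$ be the corresponding Borel probability measure on $X_\Omega$. For every $(x,y)\in X_\Omega$, $$ \liminf_{n\to\infty}\frac{-\log_{m_2}(\mathbb{P}_\mu(B_n(x,y)))}{L(n)}\le\frac{q-1}{q}\log_{m_2}(t_\varnothing). $$ Consequently $\dim_H(X_\Omega)=\frac{q-1}{q}\log_{m_2}(t_\varnothing)$.
   Context: Setting. Let $q\ge 2$ and $m_1>m_2\ge 2$ be integers, $\mathcal{A}_i=\{0,\dots,m_i-1\}$, $\mathbb{N}^*=\{1,2,\dots\}$, $\Sigma_{m_1,m_2}=(\mathcal{A}_1\times\mathcal{A}_2)^{\mathbb{N}^*}$, with elements $(x,y)=(x_k,y_k)_{k\ge1}$. Put $\gamma=\log(m_2)/\log(m_1)$, $L(n)=\lceil n/\gamma\rceil$, and let $j$ be the unique non-negative integer with $q^j\le 1/\gamma<q^{j+1}$. Metric: $d((x,y),(u,v))=\max\left(m_1^{-\min\{k\ge0:(x_{k+1},y_{k+1})\ne(u_{k+1},v_{k+1})\}},\ m_1^{-\gamma\min\{k\ge0:y_{k+1}\ne v_{k+1}\}}\right)$ (with $m_1^{-\infty}=0$); the closed ball of radius $m_1^{-n}$ is $B_n(x,y)=\{(u,v): u_k=x_k\ \forall k\le n,\ v_k=y_k\ \forall k\le L(n)\}$. Hausdorff dimension is with respect to $d$. Let $\Omega\subset\Sigma_{m_1,m_2}$ be nonempty and closed (product topology), and $X_\Omega=\{(x_k,y_k)_{k\ge1}:(x_{iq^\ell},y_{iq^\ell})_{\ell\ge0}\in\Omega\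 \forall i\ge1,\ q\nmid i\}$. For a Borel probability measure $\mu$ on $\Omega$, $\mathbb{P}_\mu$ is the unique Borel probability measure on $\Sigma_{m_1,m_2}$ (supported on $X_\Omega$) with $\mathbb{P}_\mu([(x_1,y_1)\cdots(x_n,y_n)])=\prod_{i\le n,\ q\nmid i}\mu([(x_i,y_i)(x_{qi},y_{qi})\cdots(x_{q^ri},y_{q^ri})])$, $r$ being given by $q^ri\le n<q^{r+1}i$. Prefixes. For $u=(x_1,y_1)\cdots(x_p,y_p)y_{p+1}\cdots y_{p+\ell}$, the generalized cylinder $[u]$ is the set of sequences of $\Sigma_{m_1,m_2}$ whose first $p$ letters are $(x_1,y_1),\dots,(x_p,y_p)$ and whose second coordinates at positions $p+1,\dots,p+\ell$ are $y_{p+1},\dots,y_{p+\ell}$; $\mathrm{Pref}_{p,\ell}(\Omega)$ is the set of such $u$ with $\Omega\cap[u]\ne\varnothing$. The vector $t$. For $k\ge1$, a follower of $v=(x_1,y_1)\cdots(x_k,y_k)y_{k+1}\cdots y_{k+j}\in\mathrm{Pref}_{k,j}(\Omega)$ is any $w\in\mathrm{Pref}_{k+1,j}(\Omega)$ of the form $w=(x_1,y_1)\cdots(x_k,y_k)(x_{k+1},y_{k+1})y_{k+2}\cdots y_{k+j+1}$ (for $j\ge1$ the letters $y_{k+1},\dots,y_{k+j}$ are those of $v$ and $x_{k+1},y_{k+j+1}$ are new; for $j=0$ both $x_{k+1},y_{k+1}$ are new). For each $u\in\mathrm{Pref}_{1,j}(\Omega)$ let $V_{u,j}(\Omega)$ be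 the set consisting of $u$ and all its iterated followers. There is a unique family $t\in[1,m_2^{2/(\gamma(q-1))}]^{V_{u,j}(\Omega)}$ such that for all $v=(x_1,y_1)\cdots(x_k,y_k)y_{k+1}\cdots y_{k+j}\in V_{u,j}(\Omega)$, $$t_v^{q^{j+1}\gamma}=\sum_{y'_{k+j+1}}\Big(\sum_{x'_{k+1}}t_{(x_1,y_1)\cdots(x_k,y_k)(x'_{k+1},y_{k+1})y_{k+2}\cdots y_{k+j}y'_{k+j+1}}\Big)^{q^j\gamma},$$ the sums being over the followers of $v$ (for $j=0$, $y_{k+1}$ is replaced by $y'_{k+1}$). Taking all $u\in\mathrm{Pref}_{1,j}(\Omega)$ this defines $t_v$ for every $v\in\bigcup_{k\ge1}\mathrm{Pref}_{k,j}(\Omega)$. Nested sums. All sums run over letters for which the resulting words are prefixes of $\Omega$. Set $S_{j+1}(y_1\cdots y_{j+1})=\big(\sum_{x'_1}t_{(x'_1,y_1)y_2\cdots y_{j+1}}\big)^{q^j\gamma}$ and, for $i=j,j-1,\dots,1$, $W_i(y_1\cdots y_i)=\sum_{y'_{i+1}}S_{i+1}(y_1\cdots y_iy'_{i+1})$ and $S_i(y_1\cdots y_i)=W_i(y_1\cdots y_i)^{1/q}$. Finally $t_\varnothing=\sum_{y'_1}S_1(y'_1)$, i.e. $t_\varnothing=\sum_{y'_1}(\sum_{y'_2}(\cdots(\sum_{y'_{j+1}}(\sum_{x'_1}t_{(x'_1,y'_1)y'_2\cdots y'_{j+1}})^{q^j\gamma})^{1/q}\cdots)^{1/q})^{1/q}$.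 The measure $\mu$. It is the Borel probability measure on $\Omega$ such that for $k\ge1$ and $u=(x_1,y_1)\cdots(x_k,y_k)y_{k+1}\cdots y_{k+j}\in\mathrm{Pref}_{k,j}(\Omega)$, $$\mu([u])=\frac{t_{(x_1,y_1)y_2\cdots y_{j+1}}\left(\sum_{x'_1}t_{(x'_1,y_1)y_2\cdots y_{j+1}}\right)^{q^j\gamma-1}}{t_\varnothing}\cdot\prod_{p=0}^{j-1}W_{j-p}(y_1\cdots y_{j-p})^{\frac{1-q}{q}}\cdot\prod_{p=2}^{k}\frac{t_{(x_1,y_1)\cdots(x_p,y_p)y_{p+1}\cdots y_{p+j}}\left(\sum_{x'_p}t_{(x_1,y_1)\cdots(x_{p-1},y_{p-1})(x'_p,y_p)y_{p+1}\cdots y_{p+j}}\right)^{q^j\gamma-1}}{t_{(x_1,y_1)\cdots(x_{p-1},y_{p-1})y_p\cdots y_{p-1+j}}^{q^{j+1}\gamma}} .$$ *)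

(* Defs.v *)
From HB Require Import structures.
From mathcomp Require Import all_boot all_order all_algebra.
From mathcomp Require Import all_classical all_reals all_analysis.

Set Implicit Arguments.
Unset Strict Implicit.
Unset Printing Implicit Defensive.

Import Order.TTheory GRing.Theory Num.Theory.

Local Open Scope classical_set_scope.
Local Open Scope ring_scope.

(* The alphabet {0, ..., m-1}.  Writing m as m.-1.+1 (the same number as soon
   as 0 < m) makes the type visibly inhabited, as required of the points of a
   measurable space. *)
Definition letter (m : nat) : Type := 'I_m.-1.+1.

HB.instance Definition _ (m : nat) := Finite.on (letter m).
HB.instance Definition _ (m : nat) := isPointed.Build (letter m) ord0.

(* The sequence space with its product topology.  Sequences are indexed from 0:
   z k is the letter (x_{k+1}, y_{k+1}), so the letter
   of position k >= 1 is z k.-1. *)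
Definition Sigma (m1 m2 : nat) : Type :=
  {ptws nat -> discrete_topology (letter m1 * letter m2)%type}.

HB.instance Definition _ m1 m2 := Pointed.on (Sigma m1 m2).
HB.instance Definition _ m1 m2 := Topological.on (Sigma m1 m2).

(* The same space with its Borel sigma-algebra. *)
Notation SigmaB m1 m2 := (g_sigma_algebraType (@open (Sigma m1 m2))).

Section HausdorffDimension.
Context {R : realType} {T : Type}.
Variable d : T -> T -> R.
Local Open Scope ereal_scope.

(* -oo on the empty set. *)
Definition diam (A : set T) : \bar R :=
  ereal_sup [set (d a b)%:E | a in A & b in A].

(* diam(A)^s, with the empty set contributing 0 (also for s = 0) *)
Definition gauge (s : R) (A : set T) : \bar R :=
  if A == set0 then 0 else diam A `^ s.

Definition hausdorff_pre (s delta : R) (A : set T) : \bar R :=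
  ereal_inf [set \sum_(0 <= i <oo) gauge s (U i) | U in
    [set U : nat -> set T | A `<=` \bigcup_i U i /\
                            forall i, diam (U i) <= delta%:E]].

Definition hausdorff_measure (s : R) (A : set T) : \bar R :=
  ereal_sup [set hausdorff_pre s delta A | delta in [set e : R | (0 < e)%R]].

Definition hausdorff_dim (A : set T) : \bar R :=
  ereal_inf [set s%:E | s in
    [set s : R | (0 <= s)%R /\ hausdorff_measure s A = 0]].

End HausdorffDimension.

Section Metric.
Variables (R : realType) (m1 m2 : nat).

Definition gamma : R := ln m2%:R / ln m1%:R.

Definition Lnat (n : nat) : nat := `|Num.ceil (n%:R / gamma)|%N.

(* m1 ^ (- s * min {k | D k}), and 0 if D holds nowhere. *)
Definition first_pow (s : R) (D : pred nat) : R :=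
  match pselect (exists k, D k) with
  | left exD => m1%:R `^ (- (s * (ex_minn exD)%:R))
  | right _ => 0
  end.

Definition dist (z w : Sigma m1 m2) : R :=
  Num.max (first_pow 1 (fun k => z k != w k))
          (first_pow gamma (fun k => (z k).2 != (w k).2)).

(* The closed ball of radius m1^-n. *)
Definition Bn (n : nat) (z : Sigma m1 m2) : set (Sigma m1 m2) :=
  [set w | (forall k, (k < n)%N -> (w k).1 = (z k).1) /\
           (forall k, (k < Lnat n)%N -> (w k).2 = (z k).2)].

Definition logE (b : nat) (x : \bar R) : \bar R :=
  (lne x * ((ln b%:R)^-1)%:E)%E.

End Metric.

Section Prefixes.
Variables (m1 m2 : nat).

(* (x_1,y_1)...(x_p,y_p) y_{p+1}...y_{p+l} is coded by the pair of the list of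
   its first p letters and of the list y_{p+1}, ..., y_{p+l}. *)
Definition word : Type := (seq (letter m1 * letter m2) * seq (letter m2))%type.

Definition cyl (u : word) : set (Sigma m1 m2) :=
  [set z | [seq z k | k <- iota 0 (size u.1)] = u.1 /\
           [seq (z k).2 | k <- iota (size u.1) (size u.2)] = u.2].

Variable Omega : set (Sigma m1 m2).

Definition is_prefix (u : word) : Prop := Omega `&` cyl u !=set0.

Definition Pref (p l : nat) : set word :=
  [set u | [/\ size u.1 = p, size u.2 = l & is_prefix u]].

(* w is a follower of v: a second coordinate y' is appended to v and a first
   coordinate x is attached to the first second-coordinate letter y which has
   none (y = y' when v.2 is empty). *)
Definition follower (v w : word) : Prop :=
  exists (x : letter m1) (y y' : letter m2) (ys : seq (letter m2)),
    [/\ rcons v.2 y' = y :: ys, w = (rcons v.1 (x, y), ys) & is_prefix w].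

(* descendant u is the set V_{u,j}. *)
Inductive descendant (u : word) : word -> Prop :=
| descendant_self : descendant u u
| descendant_follower v w :
    descendant u v -> follower v w -> descendant u w.

End Prefixes.

Section VectorT.
Variables (R : realType) (m1 m2 q j : nat) (Omega : set (Sigma m1 m2)).
Variable t : word m1 m2 -> R.

Let g : R := gamma R m1 m2.

(* \sum_{x'_{k+1}} t_{s (x'_{k+1}, y_{k+1}) y_{k+2} ...}
   for s of length k and ys = y_{k+1} y_{k+2} ... *)
Definition xsum (s : seq (letter m1 * letter m2)) (ys : seq (letter m2)) : R :=
  if ys is y :: ys' then
    \sum_(x : letter m1 | `[< is_prefix Omega (rcons s (x, y), ys') >])
      t (rcons s (x, y), ys')
  else 0.

Definition t_equation (v : word m1 m2) : Prop :=
  t v `^ ((q ^ j.+1)%:R * g) =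
  \sum_(y' : letter m2 | `[< is_prefix Omega (v.1, rcons v.2 y') >])
    xsum v.1 (rcons v.2 y') `^ ((q ^ j)%:R * g).

Definition is_t : Prop :=
  forall u, Pref Omega 1 j u -> forall v, descendant Omega u v ->
    1 <= t v <= m2%:R `^ (2 / (g * (q%:R - 1))) /\ t_equation v.

(* nestS_rec n ys is S_i(ys) where i = size ys and n = j + 1 - i. *)
Fixpoint nestS_rec (n : nat) (ys : seq (letter m2)) : R :=
  if n is n'.+1 then
    (\sum_(y' : letter m2 | `[< is_prefix Omega ([::], rcons ys y') >])
       nestS_rec n' (rcons ys y')) `^ (q%:R^-1)
  else xsum [::] ys `^ ((q ^ j)%:R * g).

Definition nestS (ys : seq (letter m2)) : R := nestS_rec (j.+1 - size ys) ys.

Definition nestW (ys : seq (letter m2)) : R :=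
  \sum_(y' : letter m2 | `[< is_prefix Omega ([::], rcons ys y') >])
    nestS (rcons ys y').

Definition t_empty : R :=
  \sum_(y : letter m2 | `[< is_prefix Omega ([::], [:: y]) >]) nestS [:: y].

(* For u = (x_1,y_1)...(x_k,y_k) y_{k+1}...y_{k+j}: the second coordinates
   y_1...y_{k+j}, and the word (x_1,y_1)...(x_p,y_p) y_{p+1}...y_{p+j}. *)
Definition yword (u : word m1 m2) : seq (letter m2) :=
  [seq a.2 | a <- u.1] ++ u.2.

Definition window (u : word m1 m2) (p : nat) : word m1 m2 :=
  (take p u.1, take j (drop p (yword u))).

(* t_{(x_1,y_1)...(x_p,y_p) y_{p+1}...y_{p+j}} times
   (\sum_{x'_p} t_{...(x'_p,y_p) y_{p+1}...y_{p+j}}) ^ (q^j gamma - 1). *)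
Definition mu_num (u : word m1 m2) (p : nat) : R :=
  t (window u p) *
  xsum (take p.-1 u.1) (take j.+1 (drop p.-1 (yword u)))
    `^ ((q ^ j)%:R * g - 1).

Definition mu_formula (u : word m1 m2) : R :=
  mu_num u 1 / t_empty
  * \prod_(0 <= p < j) nestW (take (j - p) (yword u)) `^ ((1 - q%:R) / q%:R)
  * \prod_(2 <= p < (size u.1).+1)
      (mu_num u p / t (window u p.-1) `^ ((q ^ j.+1)%:R * g)).

Definition is_mu (mu : probability (SigmaB m1 m2) R) : Prop :=
  mu Omega = 1%E /\
  forall k u, (0 < k)%N -> Pref Omega k j u -> mu (cyl u) = (mu_formula u)%:E.

End VectorT.

Section ProductLike.
Variables (R : realType) (m1 m2 q : nat).

(* (z_{i q^l})_{l >= 0}, for i >= 1 *)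
Definition subseq_at (i : nat) (z : Sigma m1 m2) : Sigma m1 m2 :=
  fun l => z (i * q ^ l).-1.

Definition XOmega (Omega : set (Sigma m1 m2)) : set (Sigma m1 m2) :=
  [set z | forall i, (0 < i)%N -> ~~ (q %| i)%N -> Omega (subseq_at i z)].

Definition letters (n : nat) (z : Sigma m1 m2) : word m1 m2 :=
  ([seq z k | k <- iota 0 n], [::]).

(* trunc_log q (n %/ i) is the r with q^r i <= n < q^(r+1) i; the words of
   length n are the lists of the first n letters of the sequences. *)
Definition is_P (mu P : probability (SigmaB m1 m2) R) : Prop :=
  forall n z, P (cyl (letters n z)) =
    (\prod_(1 <= i < n.+1 | ~~ (q %| i)%N)
       mu (cyl (letters (trunc_log q (n %/ i)).+1 (subseq_at i z))))%E.

End ProductLike.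

(* Main.v *)
(* Splitting the positions into the chains (i q^l)_l, q not dividing i, which
   are independent under P, the measure of a ball is the product over i of
   the mu-measures of cylinders of the form "k full letters, r second
   coordinates".  Their logarithms are explicit sums of ln t, of the ln of the
   inner sums, and of the ln of the nested sums S_i.  Adding over i,
     ln P(B_n(z)) + #{i <= L(n) : q does not divide i} ln t_empty
   becomes a combination of differences gamma Q S(L(n)/Q) - S(n), where S is
   a sum of n uniformly bounded terms.
   For every z, the averages of such a difference with the telescoping weights
   1/n - 1/(n+1) are bounded, because each term of S receives almost the same
   total weight from both sides; as the harmonic series diverges, the
   difference cannot stay below - e n, which bounds the liminf.
   For P-almost every z, the law of large numbers along the chains (Chernoff
   bound and Borel-Cantelli) shows that S(n)/n is almost constant, so that
   the difference is o(n), which bounds P(B_n(z)) from above for large n.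
   The dimension follows: from above by covering with the balls of large
   measure, which are disjoint at each level, and from below by the mass
   distribution principle, the balls being those of an ultrametric. *)
Require Import Defs.
From HB Require Import structures.
From mathcomp Require Import all_boot all_order all_algebra.
From mathcomp Require Import all_classical all_reals all_analysis.
From mathcomp Require Import zify ring lra.

Set Implicit Arguments.
Unset Strict Implicit.
Unset Printing Implicit Defensive.

Import Order.TTheory GRing.Theory Num.Theory.

Local Open Scope classical_set_scope.
Local Open Scope ring_scope.

(** * Words and cylinders *)

Section Words.
Variables (m1 m2 : nat).
Implicit Types (z w x : Sigma m1 m2).

(** For an arbitrary point, S(n)/n need not converge, so no law of large numbers can give the
    pointwise bound. Logarithmic averages are used because, up to a bounded error, they do not see
    the dilation n -> n/(gamma Q). The condition q^j <= 1/gamma < q^(j+1) enters through a count: if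
    a chain has r positions up to L(n), it has between r - j - 1 and r - j positions up to n. So mu
    is needed on very few shapes of generalized cylinder, and one closed formula covers them all.
    Every chain contributes - ln t_empty exactly once, and about (q - 1)/q L(n) chains meet the
    ball: this is the origin of the dimension formula. As mu and P are given by their values on
    cylinders, events are reduced to finitely many letters and expectations are finite sums over
    words. *)

Definition agree (n : nat) z w := forall k, (k < n)%N -> z k = w k.

(** With [X := Prop] this also applies to sets: [fdep n A] then says that A is a union of cylinders
    of length n, hence clopen. *)
Definition fdep (X : Type) (n : nat) (g : Sigma m1 m2 -> X) :=
  forall z w, agree n z w -> g z = g w.

Lemma fdep_le (X : Type) n n' (g : Sigma m1 m2 -> X) :
  (n <= n')%N -> fdep n g -> fdep n' g.
Proof.
move=> le gn z w zw; apply: gn => k kn; apply: zw; exact: leq_trans kn le.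
Qed.

Definition upd z (k : nat) (a : letter m1 * letter m2) : Sigma m1 m2 :=
  fun i => if i == k then a else z i.

Definition cylN (n : nat) z : set (Sigma m1 m2) := cyl (letters n z).

Lemma cylNE n z : cylN n z = [set w | agree n z w].
Proof.
rewrite /cylN /cyl /letters; apply/seteqP; split=> w /=.
  rewrite size_map size_iota => -[/eq_in_map e _] k kn.
  by rewrite e// mem_iota.
rewrite size_map size_iota => e; split=> //.
by apply/eq_in_map => k; rewrite mem_iota => /= kn; rewrite e.
Qed.

Lemma agree_sym n z w : agree n z w -> agree n w z.
Proof. by move=> e k kn; rewrite e. Qed.

Lemma agree_trans n z w x : agree n z w -> agree n w x -> agree n z x.
Proof. by move=> e f k kn; rewrite e// f. Qed.

Lemma fdep_cylN n w : fdep n (cylN n w).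
Proof.
move=> z z' zz'; rewrite cylNE; apply/propext; split => /= h.
  exact: agree_trans h zz'.
exact: agree_trans h (agree_sym zz').
Qed.

Lemma open_cylN n z : open (cylN n z).
Proof.
rewrite cylNE.
have -> : [set w | agree n z w] =
    \bigcap_(k in [set` 'I_n]) (fun w => w (nat_of_ord k)) @^-1` [set z k].
  apply/seteqP; split=> w /= h; first by move=> k _ /=; rewrite h.
  by move=> k kn; rewrite (h (Ordinal kn)).
rewrite bigcap_fset_set; last exact: finite_finset.
apply: big_ind => [|A B oA oB|k _]; [exact: openT|exact: openI|].
apply: open_comp => [w _|]; last exact: discrete_open.
exact: (@proj_continuous nat (fun=> discrete_topology (letter m1 * letter m2)%type)).
Qed.

Lemma open_fdep n (A : set (Sigma m1 m2)) : fdep n A -> open A.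
Proof.
move=> dA; rewrite openE => z Az; apply: (@filterS _ _ _ (cylN n z)); last first.
  by apply: open_nbhs_nbhs; split; [exact: open_cylN|rewrite cylNE].
by rewrite cylNE => w zw; rewrite -(dA _ _ zw).
Qed.

Lemma measurable_fdep n (A : set (Sigma m1 m2)) :
  fdep n A -> measurable (A : set (SigmaB m1 m2)).
Proof. by move=> dA; apply: sub_sigma_algebra; exact: open_fdep dA. Qed.

(** A point of A chosen in each cylinder around z gives a sequence that is eventually constant in
    every coordinate, hence converges to z. *)
Lemma closed_cylN (A : set (Sigma m1 m2)) z : closed A ->
  (forall n, A `&` cylN n z !=set0) -> A z.
Proof.
move=> cA h; have [f fP] := choice h.
apply: (@closed_cvg _ _ \oo _ f A cA) => //; first by apply: nearW => n; exact: (fP n).1.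
apply/(@pointwise_cvgP nat) => k.
suff h' : (fun n => f n k) @ \oo --> z k by [].
apply: cvg_near_cst; exists k.+1 => // n /= kn.
by have := (fP n).2; rewrite cylNE /= => /(_ _ kn) ->.
Qed.

Lemma cylN_upd n z a :
  cylN n.+1 (upd z n a) = cylN n z `&` [set w | w n = a].
Proof.
rewrite !cylNE; apply/seteqP; split=> w /=.
  move=> h; split=> [k kn|].
    by rewrite -(h k (ltnW kn)) /upd ltn_eqF.
  by rewrite -(h n)// /upd eqxx.
move=> [h e] k; rewrite ltnS leq_eqVlt /upd => /orP[/eqP->|kn].
  by rewrite eqxx.
by rewrite ltn_eqF// h.
Qed.

(** * Expectations as finite sums over words *)

Section Expectation.
Variable R : realType.
Implicit Types (f g : Sigma m1 m2 -> R) (m : probability (SigmaB m1 m2) R).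

(* Words are represented by points of Sigma, whose letters at positions
   r, ..., r + n - 1 are overwritten in turn. *)
Fixpoint bsum (n r : nat) g z : R :=
  if n is n'.+1 then \sum_(a : letter m1 * letter m2) bsum n' r.+1 g (upd z r a)
  else g z.

Lemma bsum_cat n n' r g z :
  bsum (n + n') r g z = bsum n r (bsum n' (r + n) g) z.
Proof.
elim: n r z => [|n IH] r z /=; first by rewrite addn0.
by apply: eq_bigr => a _; rewrite IH addSnnS.
Qed.

Lemma le_bsum n r f g z : (forall x, f x <= g x) -> bsum n r f z <= bsum n r g z.
Proof. by move=> fg; elim: n r z => //= n IH r z; exact: ler_sum. Qed.

Lemma bsumZ n r c f z : bsum n r (fun x => c * f x) z = c * bsum n r f z.
Proof.
elim: n r z => //= n IH r z; rewrite mulr_sumr.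
by apply: eq_bigr => a _.
Qed.

(** This is the integral of f when f depends on the first n letters only; the letters of the base
    point that matter are all overwritten. *)
Definition expect m (n : nat) f : R :=
  bsum n 0 (fun x => f x * fine (m (cylN n x))) (fun=> point).

Lemma measure_fineE m (A : set (SigmaB m1 m2)) : measurable A -> m A = (fine (m A))%:E.
Proof. by move=> mA; rewrite fineK// fin_num_measure. Qed.

Lemma measure_split (F : finType) (phi : Sigma m1 m2 -> F) m
    (A : set (SigmaB m1 m2)) n :
  fdep n phi -> measurable A ->
  fine (m A) = \sum_(a : F) fine (m (A `&` [set z | phi z = a])).
Proof.
move=> dphi mA.
have mB a : measurable (A `&` [set z | phi z = a] : set (SigmaB m1 m2)).
  by apply: measurableI => //; apply: (@measurable_fdep n) => z w zw /=; rewrite (dphi _ _ zw).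
apply: EFin_inj; rewrite -measure_fineE// -sumEFin.
under eq_bigr do rewrite -measure_fineE//.
have {1}-> : A = \bigcup_(a in [set` enum F]) (A `&` [set z | phi z = a]).
  apply/seteqP; split=> [z Az|z [a _ []]//].
  by exists (phi z) => //=; rewrite mem_enum.
rewrite measure_fin_bigcup//; last first.
  by move=> a b _ _ [z [[_ /= <-] [_ /= <-]]].
by rewrite -fsbig_seq ?enum_uniq//= big_enum.
Qed.

Lemma fine_measure_ge0 m (A : set (SigmaB m1 m2)) : 0 <= fine (m A).
Proof. exact: fine_ge0. Qed.

Lemma le_fine_measure m (A B : set (SigmaB m1 m2)) :
  measurable A -> measurable B -> A `<=` B -> fine (m A) <= fine (m B).
Proof.
move=> mA mB AB; rewrite -lee_fin -!measure_fineE//.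
by apply: le_measure; rewrite ?inE.
Qed.

Lemma measurable_cylN n z : measurable (cylN n z : set (SigmaB m1 m2)).
Proof. exact: (measurable_fdep (@fdep_cylN n z)). Qed.

Lemma measure_bsum m (A : set (SigmaB m1 m2)) n r z : measurable A ->
  fine (m (cylN r z `&` A)) =
  bsum n r (fun x => fine (m (cylN (r + n) x `&` A))) z.
Proof.
move=> mA; elim: n r z => [|n IH] r z /=; first by rewrite addn0.
rewrite (@measure_split _ (fun z => z r) _ _ r.+1); last 2 first.
- by move=> x y; exact.
- by apply: measurableI => //; exact: measurable_cylN.
apply: eq_bigr => a _; rewrite -addSnnS -IH setIAC -cylN_upd; congr (fine (m _)).
Qed.

Definition ind (A : set (Sigma m1 m2)) (x : Sigma m1 m2) : R := (`[< A x >])%:R.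

Lemma cylN_ind m (A : set (SigmaB m1 m2)) n x : fdep n A ->
  fine (m (cylN n x `&` A)) = ind A x * fine (m (cylN n x)).
Proof.
move=> dA; rewrite /ind; case: asboolP => Ax.
  rewrite mul1r; congr (fine (m _)); apply: setIidl.
  by rewrite cylNE => w xw; rewrite -(dA _ _ xw).
rewrite mul0r (_ : _ `&` _ = set0) ?measure0//.
by rewrite cylNE; apply/seteqP; split=> // w [/= xw]; rewrite -(dA _ _ xw).
Qed.

Lemma cylN0 z : cylN 0 z = setT.
Proof. by rewrite cylNE; apply/seteqP; split. Qed.

Lemma measure_expect m (A : set (SigmaB m1 m2)) n : fdep n A ->
  fine (m A) = expect m n (ind A).
Proof.
move=> dA; have mA := measurable_fdep dA.
rewrite -{1}[A]setTI -(cylN0 (fun=> point)) (measure_bsum m n)// /expect add0n.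
by congr (bsum _ _ _ _); apply/funext => x; rewrite cylN_ind.
Qed.

Lemma le_expect m n f g : (forall x, f x <= g x) -> expect m n f <= expect m n g.
Proof. by move=> fg; apply: le_bsum => x; rewrite ler_wpM2r// fine_measure_ge0. Qed.

Lemma expectZ m n c f : expect m n (fun x => c * f x) = c * expect m n f.
Proof.
rewrite /expect -bsumZ; congr (bsum _ _ _ _).
by apply/funext => x; rewrite mulrA.
Qed.

Lemma bsumD n r f g z :
  bsum n r (fun x => f x + g x) z = bsum n r f z + bsum n r g z.
Proof.
elim: n r z => //= n IH r z; rewrite -big_split /=.
by apply: eq_bigr => a _.
Qed.

Lemma expectD m n f g : expect m n (fun x => f x + g x) = expect m n f + expect m n g.
Proof.
rewrite /expect -bsumD; congr (bsum _ _ _ _).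
by apply/funext => x; rewrite mulrDl.
Qed.

Lemma expect_cst m n c : expect m n (fun=> c) = c.
Proof.
have -> : (fun=> c) = (fun x : Sigma m1 m2 => c * ind setT x).
  by apply/funext => x; rewrite /ind asboolT ?mulr1.
by rewrite expectZ -measure_expect ?probability_setT//= ?mulr1// => z w.
Qed.

(** The measures of the one-letter extensions of a cylinder add up to its measure, so the letters on
    which f does not depend sum out. *)
Lemma expect_widen m n n' f : fdep n f -> (n <= n')%N -> expect m n' f = expect m n f.
Proof.
move=> df /subnKC <-; elim: (n' - n)%N => [|d IH]; first by rewrite addn0.
rewrite addnS -{}IH /expect -addn1 bsum_cat; congr (bsum _ _ _ _).
apply/funext => x /=; rewrite add0n.
have := @measure_bsum m setT 1 (n + d) x measurableT.
rewrite setIT /= => ->; rewrite mulr_sumr; apply: eq_bigr => a _.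
rewrite addn1 setIT; congr (_ * _); apply: df => k kn; rewrite /upd ltn_eqF//.
exact: leq_trans kn (leq_addr _ _).
Qed.

End Expectation.
End Words.

(** * Independence of the chains *)

Section Chains.
Variables (q : nat).
Hypothesis hq : (2 <= q)%N.

Let q_gt0 : (0 < q)%N. Proof. exact: ltnW. Qed.

(* The number of l such that i q^l <= M; trunc_log q 0 = 0, hence the test. *)
Definition cnt (i M : nat) : nat :=
  if (M < i)%N then 0%N else (trunc_log q (M %/ i)).+1.

Lemma cntP i M l : (0 < i)%N -> (l < cnt i M)%N = (i * q ^ l <= M)%N.
Proof.
move=> i0; rewrite /cnt; case: (ltnP M i) => Mi.
  rewrite ltn0; apply/esym/negbTE; rewrite -ltnNge (leq_trans Mi)//.
  by rewrite leq_pmulr// expn_gt0 q_gt0.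
have Mi0 : (0 < M %/ i)%N by rewrite divn_gt0.
rewrite ltnS mulnC -leq_divRL//.
apply/idP/idP => h; last by apply: trunc_log_max.
apply: leq_trans (trunc_logP hq Mi0).
by rewrite leq_exp2l.
Qed.

Lemma leq_cnt i M M' : (0 < i)%N -> (M <= M')%N -> (cnt i M <= cnt i M')%N.
Proof.
move=> i0 MM'; rewrite leqNgt; apply/negP; rewrite cntP// => h.
have : (cnt i M' < cnt i M')%N by rewrite cntP// (leq_trans h).
by rewrite ltnn.
Qed.

Lemma cnt_eq0 i M : (0 < i)%N -> (cnt i M == 0)%N = (M < i)%N.
Proof. by move=> i0; rewrite -leqn0 leqNgt cntP// expn0 muln1 -ltnNge. Qed.

Lemma cnt_uniq i M k : (0 < i)%N ->
  (forall l, (l < k)%N = (i * q ^ l <= M)%N) -> cnt i M = k.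
Proof.
move=> i0 h; apply/eqP; rewrite eqn_leq; apply/andP; split; rewrite leqNgt.
  by rewrite cntP// -h ltnn.
by rewrite h -cntP// ltnn.
Qed.

(** Lowering the cutoff by a factor q^s drops s terms of a chain (all of them if there are fewer).
    This turns ranges r - s inside the chains into sums evaluated at [L n %/ q ^ s]. *)
Lemma cnt_divn i M s : (0 < i)%N -> cnt i (M %/ q ^ s) = (cnt i M - s)%N.
Proof.
move=> i0; apply: cnt_uniq => // l; rewrite ltn_subRL cntP//.
by rewrite leq_divRL ?expn_gt0 ?q_gt0// -mulnA -expnD addnC.
Qed.

Lemma qdecomp n : (0 < n)%N ->
  exists i l, [/\ (0 < i)%N, ~~ (q %| i)%N & n = (i * q ^ l)%N].
Proof.
elim/ltn_ind: n => n IH n0; have [qn|qn] := boolP (q %| n)%N; last first.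
  by exists n, 0%N; rewrite muln1.
have n'0 : (0 < n %/ q)%N by rewrite divn_gt0// dvdn_leq.
have [|i [l [i0 qi e]]] := IH (n %/ q)%N _ n'0; first exact: ltn_Pdiv.
exists i, l.+1; split=> //.
by rewrite expnSr mulnA -e divnK.
Qed.

Lemma qdecomp_uniq i l i' l' : (0 < i)%N -> ~~ (q %| i)%N -> ~~ (q %| i')%N ->
  (i * q ^ l = i' * q ^ l')%N -> i = i' /\ l = l'.
Proof.
move=> i0; elim: l l' => [|l IH] [|l'] qi qi'; rewrite ?muln1.
- by [].
- by move=> e; rewrite e expnSr mulnA dvdn_mull in qi.
- by move=> e; rewrite -e expnSr mulnA dvdn_mull in qi'.
rewrite !expnSr !mulnA => /eqP; rewrite eqn_pmul2r// => /eqP /(IH _ qi qi').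
by move=> [-> ->].
Qed.

Lemma cntS_neq i M : (0 < i)%N -> (forall l, M.+1 != i * q ^ l)%N ->
  cnt i M.+1 = cnt i M.
Proof.
move=> i0 h; apply: cnt_uniq => // l.
by rewrite cntP// [RHS]leq_eqVlt eq_sym (negbTE (h l)).
Qed.

Lemma cntS_eq i M l : (0 < i)%N -> M.+1 = (i * q ^ l)%N ->
  cnt i M = l /\ cnt i M.+1 = l.+1.
Proof.
move=> i0 e; split; apply: cnt_uniq => // k.
  by rewrite -[RHS]ltnS e ltn_pmul2l// ltn_exp2l.
by rewrite e leq_pmul2l// leq_exp2l.
Qed.

Variables (m1 m2 : nat).
Implicit Types (z w x : Sigma m1 m2).

Lemma subseq_upd_eq i l M z a : (0 < i)%N -> M.+1 = (i * q ^ l)%N ->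
  subseq_at q i (upd z M a) = upd (subseq_at q i z) l a.
Proof.
move=> i0 e; apply/funext => k; rewrite /subseq_at /upd.
suff -> : ((i * q ^ k).-1 == M) = (k == l) by [].
have : (0 < i * q ^ k)%N by rewrite muln_gt0 i0 expn_gt0 q_gt0.
by move=> /prednK h; rewrite -eqSS h e eqn_pmul2l// eqn_exp2l.
Qed.

Lemma subseq_upd_neq i M z a : (0 < i)%N -> (forall l, M.+1 != i * q ^ l)%N ->
  subseq_at q i (upd z M a) = subseq_at q i z.
Proof.
move=> i0 h; apply/funext => k; rewrite /subseq_at /upd.
have : (0 < i * q ^ k)%N by rewrite muln_gt0 i0 expn_gt0 q_gt0.
by move=> /prednK e; rewrite -eqSS e eq_sym (negbTE (h k)).
Qed.

Lemma agree_subseq i M z w : (0 < i)%N -> agree M z w ->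
  agree (cnt i M) (subseq_at q i z) (subseq_at q i w).
Proof.
move=> i0 zw k; rewrite cntP// => h; apply: zw.
by rewrite prednK// muln_gt0 i0 expn_gt0 q_gt0.
Qed.

Lemma fdep_subseq (X : Type) i M (f : Sigma m1 m2 -> X) : (0 < i)%N ->
  fdep (cnt i M) f -> fdep M (fun z => f (subseq_at q i z)).
Proof. by move=> i0 df z w zw; apply: df; exact: agree_subseq. Qed.

Definition heads (M : nat) : seq nat :=
  [seq i <- index_iota 1 M.+1 | ~~ (q %| i)%N].

Lemma mem_heads M i : (i \in heads M) = [&& (0 < i)%N, (i <= M)%N & ~~ (q %| i)%N].
Proof. by rewrite mem_filter mem_index_iota ltnS andbC -andbA. Qed.

Lemma uniq_heads M : uniq (heads M).
Proof. exact/filter_uniq/iota_uniq. Qed.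

Lemma heads_gt0 M i : i \in heads M -> (0 < i)%N.
Proof. by rewrite mem_heads => /and3P[]. Qed.

Section Independence.
Variable R : realType.

(* The letter at position m + 1 = i q^l only enters the factor of the chain i,
   so the sum over it goes through the product. *)
Lemma bsum_chains (H : nat -> nat -> Sigma m1 m2 -> R) M :
  (forall i r x, (0 < i)%N -> (r < cnt i M)%N ->
    \sum_(a : letter m1 * letter m2) H i r.+1 (upd x r a) = H i r x) ->
  forall n m z, (m + n)%N = M ->
  bsum n m (fun x => \prod_(i <- heads M) H i (cnt i M) (subseq_at q i x)) z =
  \prod_(i <- heads M) H i (cnt i m) (subseq_at q i z).
Proof.
move=> HH; elim=> [|n IH] m z mn /=; first by rewrite -mn addn0.
under eq_bigr do rewrite IH ?addSnnS//.
have [i0 [l0 [i00 qi0 e]]] := qdecomp (ltn0Sn m).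
have mM : (m < M)%N by rewrite -mn addnS ltnS leq_addr.
have i0in : i0 \in heads M.
  rewrite mem_heads i00 qi0 andbT /= (leq_trans _ mM)// e.
  by rewrite leq_pmulr// expn_gt0 q_gt0.
have [c0 c1] := cntS_eq i00 e.
rewrite [RHS](bigD1_seq i0) ?uniq_heads//= -HH//; last first.
  by rewrite c0 -c1 leq_cnt.
rewrite mulr_suml; apply: eq_bigr => a _.
rewrite (bigD1_seq i0) ?uniq_heads//= c0 c1 (subseq_upd_eq _ _ i00 e).
congr (_ * _); rewrite big_seq_cond [RHS]big_seq_cond.
apply: eq_bigr => i /andP[]; rewrite mem_heads => /and3P[ig0 _ qi] ii0.
have ne l : m.+1 != (i * q ^ l)%N.
  apply/eqP; rewrite e => /(qdecomp_uniq i00 qi0 qi)[ee _].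
  by rewrite ee eqxx in ii0.
by rewrite cntS_neq// subseq_upd_neq.
Qed.

Variables (mu P : probability (SigmaB m1 m2) R).
Hypothesis hP : is_P q mu P.

Lemma P_cylN M z : fine (P (cylN M z)) =
  \prod_(i <- heads M) fine (mu (cylN (cnt i M) (subseq_at q i z))).
Proof.
rewrite hP -(big_filter _ (fun i => ~~ (q %| i)%N)) -/(heads M).
rewrite big_seq [RHS]big_seq.
have -> : (\prod_(i <- heads M | i \in heads M)
    mu (cyl (letters (trunc_log q (M %/ i)).+1 (subseq_at q i z))) =
  \prod_(i <- heads M | i \in heads M)
    (fine (mu (cylN (cnt i M) (subseq_at q i z))))%:E)%E.
  apply: eq_bigr => i; rewrite mem_heads => /and3P[_ iM _].
  rewrite -measure_fineE; last exact: measurable_cylN.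
  by rewrite /cylN /cnt ltnNge iM.
by rewrite prodEFin.
Qed.

Lemma expect_prod M (f : nat -> Sigma m1 m2 -> R) :
  expect P M (fun z => \prod_(i <- heads M) f i (subseq_at q i z)) =
  \prod_(i <- heads M) expect mu (cnt i M) (f i).
Proof.
(* Unnormalised conditional expectation of [f i] given the first r letters of the chain; summing
   over the next letter goes one level down. *)
pose H i r x := bsum (cnt i M - r) r
  (fun x => f i x * fine (mu (cylN (cnt i M) x))) x.
have HH i r x : (0 < i)%N -> (r < cnt i M)%N ->
    \sum_(a : letter m1 * letter m2) H i r.+1 (upd x r a) = H i r x.
  move=> i0 rM; rewrite /H; move: rM; case E : (cnt i M - r)%N => [|k].
    by move=> rM; rewrite -subn_gt0 E in rM.
  by move=> _; rewrite subnS E.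
have := bsum_chains HH (fun=> point) (add0n M).
rewrite /expect => h; transitivity (bsum M 0
  (fun x => \prod_(i <- heads M) H i (cnt i M) (subseq_at q i x)) (fun=> point)).
  congr (bsum _ _ _ _); apply/funext => x; rewrite P_cylN -big_split /=.
  by apply: eq_bigr => i _; rewrite /H subnn.
rewrite h big_seq [RHS]big_seq; apply: eq_bigr => i.
rewrite mem_heads => /and3P[i0 _ _].
have -> : cnt i 0 = 0%N by apply/eqP; rewrite cnt_eq0.
by rewrite /H subn0.
Qed.

Lemma P_chains M (C : nat -> set (Sigma m1 m2)) :
  (forall i, (0 < i)%N -> fdep (cnt i M) (C i)) ->
  fine (P [set z | forall i, i \in heads M -> C i (subseq_at q i z)]) =
  \prod_(i <- heads M) fine (mu (C i)).
Proof.
move=> dC; rewrite (@measure_expect _ _ _ _ _ M); last first.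
  move=> z w zw /=; apply/propext; split=> h i iM.
    by rewrite -(fdep_subseq (heads_gt0 iM) (dC i (heads_gt0 iM)) zw); exact: h.
  by rewrite (fdep_subseq (heads_gt0 iM) (dC i (heads_gt0 iM)) zw); exact: h.
transitivity (\prod_(i <- heads M) expect mu (cnt i M) (ind R (C i))); last first.
  rewrite big_seq [RHS]big_seq; apply: eq_bigr => i iM.
  by rewrite -measure_expect//; apply: dC; exact: heads_gt0 iM.
rewrite -expect_prod; congr (expect _ _ _); apply/funext => z; rewrite /ind.
case: asboolP => h.
  by rewrite big_seq big1// => i /h Ci; rewrite asboolT.
have [i iM Ci] : exists2 i, i \in heads M & ~ C i (subseq_at q i z).
  apply: contrapT => h'; apply: h => i iM; apply: contrapT => Ci.
  by apply: h'; exists i.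
rewrite (bigD1_seq i) ?uniq_heads//=.
by rewrite asboolF// mul0r.
Qed.

Lemma P_chain i (C : set (Sigma m1 m2)) n : (0 < i)%N -> ~~ (q %| i)%N ->
  fdep n C -> fine (P [set z | C (subseq_at q i z)]) = fine (mu C).
Proof.
(* The cutoff is the position of index n in the chain i, so all the letters seen by C lie below it;
   the other chains get the condition [setT]. *)
move=> i0 qi dC; pose M := (i * q ^ n)%N.
have iM : i \in heads M.
  by rewrite mem_heads i0 qi andbT leq_pmulr// expn_gt0 q_gt0.
have nM : (n <= cnt i M)%N by apply: ltnW; rewrite cntP.
have := @P_chains M (fun k => if k == i then C else setT).
rewrite (bigD1_seq i) ?uniq_heads//= eqxx big1 ?mulr1; last first.
  by move=> k /negbTE ->; rewrite probability_setT.
move=> <-; last first.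
  by move=> k _; case: eqP => [->|_]; [exact: fdep_le dC|move=> z w].
congr (fine (P _)); apply/seteqP; split=> z /= h.
  by move=> k _; case: eqP => [->|].
by have := h _ iM; rewrite eqxx.
Qed.

End Independence.
End Chains.

(** * Logarithmic averages *)

Section LogAverage.
Variable R : realType.
Implicit Types (F S : nat -> R) (C e : R).

(** The weight of F m, for m from 1 to N, is 1/(m (m + 1)): this is an unnormalised logarithmic
    average of F m / m. *)
Definition wsum F (N : nat) : R :=
  \sum_(0 <= n < N) (n.+1%:R^-1 - n.+2%:R^-1) * F n.+1.

Definition logbdd F := exists B, forall N, `|wsum F N| <= B.

Lemma wsumD F G N : wsum (fun n => F n + G n) N = wsum F N + wsum G N.
Proof. by rewrite /wsum -big_split; apply: eq_bigr => n _; rewrite mulrDr. Qed.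

Lemma wsumZ c F N : wsum (fun n => c * F n) N = c * wsum F N.
Proof. by rewrite /wsum mulr_sumr; apply: eq_bigr => n _; rewrite mulrCA. Qed.

Lemma logbddD F G : logbdd F -> logbdd G -> logbdd (fun n => F n + G n).
Proof.
move=> [B HB] [B' HB']; exists (B + B') => N; rewrite wsumD.
by rewrite (le_trans (ler_normD _ _))// lerD.
Qed.

Lemma logbddZ c F : logbdd F -> logbdd (fun n => c * F n).
Proof.
move=> [B HB]; exists (`|c| * B) => N; rewrite wsumZ normrM.
by rewrite ler_wpM2l.
Qed.

Lemma weight_ge0 (n : nat) : 0 <= n.+1%:R^-1 - n.+2%:R^-1 :> R.
Proof. by rewrite subr_ge0 lef_pV2 ?posrE ?ltr0n// ler_nat. Qed.

Lemma weightE (n : nat) : n.+1%:R^-1 - n.+2%:R^-1 = (n.+1%:R * n.+2%:R)^-1 :> R.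
Proof.
have a : n.+1%:R != 0 :> R by rewrite pnatr_eq0.
have b : n.+2%:R != 0 :> R by rewrite pnatr_eq0.
move: a b; rewrite -[n.+2%:R]natr1; move: n.+1%:R => x a b.
by field; rewrite a b.
Qed.

(** The weights of the indices from g to N telescope; the maximum with 0 covers g > N. *)
Lemma tail_weight (g N : nat) : (0 < g)%N ->
  \sum_(0 <= n < N) (n.+1%:R^-1 - n.+2%:R^-1) * (g <= n.+1)%:R =
  Num.max 0 (g%:R^-1 - N.+1%:R^-1) :> R.
Proof.
move=> g0; elim: N => [|N IH].
  rewrite big_geq// max_l// subr_le0 lef_pV2 ?posrE ?ltr0n//.
  by rewrite ler_nat.
rewrite big_nat_recr//= IH; case: (leqP g N.+1) => gN.
  rewrite mulr1 !max_r; [by rewrite addrA subrK| |].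
    by rewrite subr_ge0 lef_pV2 ?posrE ?ltr0n// ler_nat (leq_trans gN).
  by rewrite subr_ge0 lef_pV2 ?posrE ?ltr0n// ler_nat.
rewrite mulr0 addr0 !max_l//.
  by rewrite subr_le0 lef_pV2 ?posrE ?ltr0n// ler_nat.
by rewrite subr_le0 lef_pV2 ?posrE ?ltr0n// ler_nat ltnW.
Qed.

Lemma sum_invsq K : \sum_(0 <= k < K) (k.+1%:R ^+ 2)^-1 <= 2 :> R.
Proof.
(* The term 1/(K + 1) makes the induction close, because 1/(k + 2)^2 <= 1/(k + 1) - 1/(k + 2). *)
suff h : \sum_(0 <= k < K.+1) (k.+1%:R ^+ 2)^-1 <= 2 - K.+1%:R^-1 :> R.
  apply: le_trans (_ : 2 - K.+1%:R^-1 <= _); last by rewrite gerBl.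
  by apply: le_trans h; rewrite big_nat_recr//= lerDl.
elim: K => [|K IH].
  rewrite big_nat1 expr1n invr1 lerBrDr; lra.
rewrite big_nat_recr//=.
have h : (K.+2%:R ^+ 2)^-1 <= K.+1%:R^-1 - K.+2%:R^-1 :> R.
  rewrite weightE lef_pV2 ?posrE ?mulr_gt0 ?exprn_gt0 ?ltr0n//.
  by rewrite expr2 ler_wpM2r// ler_nat.
by apply: (le_trans (lerD IH h)); rewrite addrA subrK.
Qed.

(** Meant for y = k + 1, G the first n with k < L n %/ Q, and v = 1/(N + 1). As G is within 1 of gam
    QQ y, the weights gam QQ / G and 1 / y differ by O(1/y^2), which is summable. The truncation v
    is scaled by gam QQ on one side only, whence the last term. *)
Lemma weight_diff (gam y G QQ v : R) : 0 < gam -> gam <= 1 ->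
  1 <= y -> 1 <= G -> 1 <= QQ -> gam * (QQ * y - 1) < G ->
  G <= gam * (QQ * y - 1) + 1 -> 0 < v ->
  `|gam * QQ * Num.max 0 (G^-1 - v) - Num.max 0 (y^-1 - v)| <=
    2 / gam * (y ^+ 2)^-1 + `|gam * QQ - 1| * v.
Proof.
move=> gam0 gam1 y1 g1 Q1 lo hi v0.
have cQ : 0 <= gam * QQ by apply: mulr_ge0; lra.
have hd : `|gam * QQ / G - y^-1| <= 2 / gam * (y ^+ 2)^-1.
  have -> : gam * QQ / G - y^-1 = (gam * QQ * y - G) / (G * y).
    by field; apply/andP; split; lra.
  (* Half the sum of [gam * (y - 1) < G] and [gam <= 1 <= G]. *)
  have Gy : gam * y / 2 <= G by nra.
  have d1 : `|gam * QQ * y - G| <= 1 by rewrite ler_norml; apply/andP; split; nra.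
  rewrite normrM normfV (ger0_norm (_ : 0 <= G * y)); last by nra.
  apply: le_trans (_ : (G * y)^-1 <= _); first by rewrite ler_piMl// invr_ge0; nra.
  rewrite -[2 / gam]invf_div -invfM lef_pV2 ?posrE; [nra| nra|].
  by rewrite mulr_gt0 ?divr_gt0 ?exprn_gt0//; lra.
have mx : forall u v : R, `|Num.max 0 u - Num.max 0 v| <= `|u - v|.
  move=> u1 u2; case: (lerP 0 u1) => h1; case: (lerP 0 u2) => h2;
    rewrite ?subr0 ?sub0r ?normrN ?normr0//.
    by rewrite ger0_norm// ger0_norm; lra.
  by rewrite ger0_norm// ler0_norm; lra.
have -> : gam * QQ * Num.max 0 (G^-1 - v) = Num.max 0 (gam * QQ * (G^-1 - v)).
  by rewrite maxr_pMr// mulr0.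
apply: le_trans (mx _ _) _.
have -> : gam * QQ * (G^-1 - v) - (y^-1 - v) =
  (gam * QQ / G - y^-1) - (gam * QQ - 1) * v by ring.
apply: le_trans (ler_normB _ _) _.
by apply: lerD => //; rewrite normrM (gtr0_norm v0).
Qed.

(** The summand is 1/(n + 2), so a bound would make the harmonic series converge. *)
Lemma wsum_harmonic_unbounded B : exists N, B < wsum (fun n => n%:R) N.
Proof.
apply: contrapT => h.
have hB N : wsum (fun n => n%:R) N <= B.
  by rewrite leNgt; apply/negP => ?; apply: h; exists N.
apply: (@dvg_harmonic R).
have e N : \sum_(0 <= k < N.+1) k.+1%:R^-1 = 1 + wsum (fun n => n%:R) N :> R.
  rewrite big_nat_recl//= invr1; congr (_ + _); apply: eq_bigr => n _.
  by rewrite weightE invfM mulrAC mulVf ?mul1r// pnatr_eq0.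
apply: nondecreasing_is_cvgn.
  apply/nondecreasing_seqP => n; rewrite /series /= big_nat_recr//= lerDl.
  by rewrite invr_ge0.
exists (1 + B) => _ [N _ <-]; apply: le_trans (_ : series harmonic N.+1 <= _).
  by rewrite /series /= big_nat_recr//= lerDl invr_ge0.
by rewrite /series /= e lerD2l.
Qed.

Lemma logbdd_not_neg F e n0 : logbdd F -> 0 < e ->
  ~ (forall n, (n0 <= n)%N -> F n <= - e * n%:R).
Proof.
move=> [B HB] e0 h.
(* Absorbs the finitely many indices below n0, where the sign of F n + e n is unknown. *)
pose c := \sum_(0 <= n < n0) (n.+1%:R^-1 - n.+2%:R^-1) * `|F n.+1 + e * n.+1%:R|.
have [N hN] := wsum_harmonic_unbounded ((B + c) / e).
have : wsum F N + e * wsum (fun n => n%:R) N <= c.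
  rewrite -wsumZ -wsumD; apply: le_trans (_ : \sum_(0 <= n < N)
    (n.+1%:R^-1 - n.+2%:R^-1) * ((n < n0)%:R * `|F n.+1 + e * n.+1%:R|) <= _).
    apply: ler_sum => n _; apply: ler_wpM2l; first exact: weight_ge0.
    case: ltnP => nn0; first by rewrite mul1r ler_norm.
    by rewrite mul0r; have := h n.+1 (leq_trans nn0 (leqnSn _)); lra.
  rewrite /c; have [le|le] := leqP N n0.
    rewrite [leRHS](big_cat_nat (leq0n _) le)//=; apply: ler_wpDr.
      by apply: sumr_ge0 => n _; rewrite mulr_ge0 ?weight_ge0.
    apply: ler_sum => n _; apply: ler_wpM2l; first exact: weight_ge0.
    by case: ltnP => _; rewrite ?mul1r// mul0r.
  rewrite (big_cat_nat (leq0n _) (ltnW le))//= -[leRHS]addr0 lerD//.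
    by rewrite ler_sum_nat// => n /andP[_ ->]; rewrite mul1r.
  rewrite big_nat_cond big1// => n.
  by rewrite andbT => /andP[nn _]; rewrite ltnNge nn mul0r mulr0.
rewrite ltr_pdivrMr// in hN.
by have := HB N; rewrite ler_norml => /andP[]; lra.
Qed.

Variables (gam : R) (L : nat -> nat).
Hypotheses (gam0 : 0 < gam) (gam1 : gam <= 1).
(** This characterises L n as the ceiling of n / gam. *)
Hypothesis ltL : forall k n, (k < L n)%N = (gam * k%:R < n%:R).

(* L n %/ Q is n / (gam Q) up to a bounded error. *)
Definition Delta (Q : nat) S (n : nat) : R :=
  gam * Q%:R * S (L n %/ Q)%N - S n.

Lemma L_ge n : (n <= L n)%N.
Proof.
case: n => // n; rewrite ltL; apply: le_lt_trans (_ : n%:R < _).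
  by rewrite ler_piMl.
by rewrite ltr_nat.
Qed.

Lemma L_le n n' : (n <= n')%N -> (L n <= L n')%N.
Proof.
move=> nn'; rewrite leqNgt; apply/negP; rewrite ltL => h.
have : (L n' < L n')%N by rewrite ltL (lt_le_trans h)// ler_nat.
by rewrite ltnn.
Qed.

Lemma L_bounds n : gam * (L n)%:R < n%:R + gam /\ n%:R <= gam * (L n)%:R.
Proof.
split; last by rewrite leNgt -ltL ltnn.
case E : (L n) => [|k]; first by rewrite mulr0 ltr_wpDl.
have : (k < L n)%N by rewrite E.
by rewrite ltL -natr1 mulrDr mulr1 ltrD2r.
Qed.

Lemma Delta_logbdd Q S C : (0 < Q)%N -> S 0%N = 0 ->
  (forall n, `|S n.+1 - S n| <= C) -> logbdd (Delta Q S).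
Proof.
(* Exchanging the sums, the increment a k of S gets the weight gam Q phi(g k)
   from the first term and phi(k + 1) from the second one, with g k the first
   n such that k < L n %/ Q; both are close to 1 / (k + 1). *)
move=> Q0 S0 SC; pose a k := S k.+1 - S k.
have C0 : 0 <= C by apply: le_trans (SC 0%N).
have SE K m : (m <= K)%N -> S m = \sum_(0 <= k < K) a k * (k < m)%:R.
  move=> mK; rewrite (big_cat_nat (leq0n _) mK)//=.
  rewrite [X in _ + X]big_nat_cond [X in _ + X]big1; last first.
    by move=> k; rewrite andbT => /andP[mk _]; rewrite ltnNge mk mulr0.
  rewrite addr0; rewrite [RHS](@eq_big_nat _ _ _ _ _ _ (fun k => S k.+1 - S k)).
    by rewrite telescope_sumr// S0 subr0.
  by move=> k /andP[_ ->]; rewrite mulr1.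
(* The condition [k < L n %/ Q] means Q (k + 1) - 1 < L n, that is gam (Q (k + 1) - 1) < n; this is
   the least such n. *)
pose g k := (Num.truncn (gam * (Q * k.+1).-1%:R)).+1.
have gP k n : (k < L n %/ Q)%N = (g k <= n)%N.
  rewrite leq_divRL// mulnC -(@prednK (Q * k.+1)) ?muln_gt0 ?Q0// ltL.
  by rewrite /g truncn_lt_nat// mulr_ge0// ltW.
(* 4 / gam is 2 / gam times the bound 2 on the sum of inverse squares. The other term is the cost of
   truncating at 1/(N + 1), summed over the L N <= (N + 1) / gam increments. *)
exists (C * (4 / gam + `|gam * Q%:R - 1| / gam)) => N.
pose K := L N.
pose phi (x : R) : R := Num.max 0 (x^-1 - N.+1%:R^-1).
have -> : wsum (Delta Q S) N = \sum_(0 <= k < K)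
    a k * (gam * Q%:R * phi (g k)%:R - phi k.+1%:R).
  rewrite /wsum [LHS](@eq_big_nat _ _ _ _ _ _ (fun n => \sum_(0 <= k < K)
    a k * (gam * Q%:R * ((n.+1%:R^-1 - n.+2%:R^-1) * (g k <= n.+1)%:R)
      - (n.+1%:R^-1 - n.+2%:R^-1) * (k < n.+1)%:R))); last first.
    move=> n /andP[_ nN]; rewrite /Delta.
    have n1 : (n.+1 <= K)%N by rewrite (leq_trans (L_ge _))// L_le.
    have n2 : (L n.+1 %/ Q <= K)%N by rewrite (leq_trans (leq_div _ _))// L_le.
    rewrite (SE K)// (SE K n.+1)// mulr_sumr -sumrB mulr_sumr.
    by apply: eq_bigr => k _; rewrite gP; ring.
  rewrite exchange_big /=; apply: eq_bigr => k _.
  rewrite -mulr_sumr; congr (_ * _); rewrite sumrB -mulr_sumr.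
  by rewrite !tail_weight.
apply: le_trans (ler_norm_sum _ _ _) _.
have hk k : `|a k * (gam * Q%:R * phi (g k)%:R - phi k.+1%:R)| <=
    C * (2 / gam * (k.+1%:R ^+ 2)^-1 + `|gam * Q%:R - 1| * N.+1%:R^-1).
  rewrite normrM; apply: ler_pM => //; first exact: SC.
  have y1 : 1 <= k.+1%:R :> R by rewrite ler1n.
  have g1 : 1 <= (g k)%:R :> R by rewrite ler1n.
  have Q1 : 1 <= Q%:R :> R by rewrite ler1n.
  have N0 : 0 < N.+1%:R^-1 :> R by rewrite invr_gt0.
  have [lo hi] : gam * (Q%:R * k.+1%:R - 1) < (g k)%:R /\
      (g k)%:R <= gam * (Q%:R * k.+1%:R - 1) + 1.
    have e : (Q * k.+1).-1%:R = Q%:R * k.+1%:R - 1 :> R.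
      by rewrite -subn1 natrB ?muln_gt0 ?Q0// natrM.
    have x0 : 0 <= gam * (Q * k.+1).-1%:R by rewrite mulr_ge0// ltW.
    have /andP[] := truncn_itv x0; rewrite e => h1 h2; split; first by rewrite /g e.
    have -> : (g k)%:R = (Num.truncn (gam * (Q * k.+1).-1%:R))%:R + 1 :> R by rewrite natr1.
    by rewrite lerD2r e.
  by rewrite /phi; apply: weight_diff.
apply: le_trans (ler_sum _ (fun k _ => hk k)) _.
rewrite -mulr_sumr ler_wpM2l// big_split /= lerD//.
  rewrite -mulr_sumr.
  apply: le_trans (ler_wpM2l _ (sum_invsq K)) _; first by rewrite divr_ge0// ltW.
  by rewrite mulrAC -natrM.
rewrite sumr_const_nat subn0 -[_ *+ K]mulr_natr -mulrA ler_wpM2l//.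
rewrite ler_pdivrMl ?ltr0n// ler_pdivlMr// mulrC.
by rewrite -[N.+1%:R]natr1 (le_trans (ltW (L_bounds N).1))// lerD2l.
Qed.

(** The slope c may depend on e, so the limit of S n / n need not be identified. It cancels because
    gam Q (L n %/ Q) differs from n by at most gam + gam Q. *)
Lemma Delta_small Q S : (0 < Q)%N ->
  (forall e, 0 < e -> exists c n0, forall n, (n0 <= n)%N ->
     `|S n - c * n%:R| <= e * n%:R) ->
  forall e, 0 < e -> exists n0, forall n, (n0 <= n)%N -> `|Delta Q S n| <= e * n%:R.
Proof.
move=> Q0 hS e e0; have [|c [n0 h]] := hS (e / 4); first by rewrite divr_gt0.
(* D collects the errors that do not grow with n; n1 makes them at most a quarter of e n. *)
pose D := e / 4 * gam + `|c| * (gam + gam * Q%:R).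
pose n1 := (Num.truncn (D / (e / 4))).+1.
exists (maxn n1 (n0 * Q)) => n; rewrite geq_max => /andP[n1n n0n].
have Ln : (n0 <= L n %/ Q)%N by rewrite leq_divRL// (leq_trans n0n)// L_ge.
have h1 := h _ Ln.
have h2 : `|S n - c * n%:R| <= e / 4 * n%:R.
  by apply: h; rewrite (leq_trans _ n0n)// leq_pmulr.
have [u1 u2] := L_bounds n.
have Dn : D <= e / 4 * n%:R.
  rewrite mulrC -ler_pdivrMr ?divr_gt0//.
  apply: le_trans (_ : n1%:R <= _); last by rewrite ler_nat.
  exact/ltW/truncnS_gt.
have eL : Q%:R * (L n %/ Q)%:R <= (L n)%:R :> R by rewrite -natrM ler_nat mulnC leq_divM.
have eL' : (L n)%:R <= Q%:R * (L n %/ Q)%:R + Q%:R :> R.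
  rewrite -natrM -natrD ler_nat {1}(divn_eq (L n) Q) mulnC leq_add2l.
  by rewrite ltnW// ltn_pmod.
have Q1 : 0 <= Q%:R :> R by [].
have x0 : 0 <= n%:R :> R by [].
move: h1 h2 u1 u2 Dn eL eL' Q1 x0; rewrite /Delta /D; move: (S _) (S n) => s s'.
move: (_ %/ _)%:R (L n)%:R Q%:R n%:R => a l QQ x h1 h2 u1 u2 Dn eL eL' Q1 x0.
have ex := mulr_ge0 (ltW e0) x0.
have v1 := ler_wpM2l (ltW gam0) eL; have v2 := ler_wpM2l (ltW gam0) eL'.
rewrite mulrDr mulrA in v2; rewrite mulrA in v1.
have k1 : `|gam * QQ * a - x| <= gam + gam * QQ.
  by rewrite ler_norml; apply/andP; split; lra.
have -> : gam * QQ * s - s' = gam * QQ * (s - c * a) - (s' - c * x) +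
  c * (gam * QQ * a - x) by ring.
have k2 : `|gam * QQ * (s - c * a)| <= e / 4 * (x + gam).
  rewrite normrM ger0_norm; last by rewrite mulr_ge0// ltW.
  apply: le_trans (ler_wpM2l _ h1) _; first by rewrite mulr_ge0// ltW.
  by rewrite mulrCA ler_wpM2l ?divr_ge0 ?(ltW e0)//; lra.
have k3 : `|c * (gam * QQ * a - x)| <= `|c| * (gam + gam * QQ).
  by rewrite normrM ler_wpM2l.
apply: le_trans (ler_normD _ _) _.
apply: le_trans (lerD (le_trans (ler_normB _ _) (lerD k2 h2)) k3) _.
by lra.
Qed.

End LogAverage.

(** * The measure of generalized cylinders *)

Section GeneralizedCylinders.
Variables (m1 m2 : nat).
Implicit Types (z w x : Sigma m1 m2).

Definition wd (k l : nat) z : word m1 m2 :=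
  ([seq z i | i <- iota 0 k], [seq (z i).2 | i <- iota k l]).

(** Here r counts all second coordinates from the start, while l in [wd k l] counts those after the
    k full letters: [wd k l] corresponds to [gcyl k (k + l)]. *)
Definition gcyl (k r : nat) z : set (Sigma m1 m2) :=
  [set w | agree k z w /\ forall i, (i < r)%N -> (w i).2 = (z i).2].

Lemma cyl_wd k l z : cyl (wd k l z) = gcyl k (k + l) z.
Proof.
rewrite /cyl /wd /gcyl; apply/seteqP; split=> w /=; rewrite !size_map !size_iota.
  move=> [/eq_in_map e /eq_in_map f].
  have e' i : (i < k)%N -> w i = z i by move=> ik; apply: e; rewrite mem_iota.
  split=> i ik; first by rewrite e'.
  have [ik'|ki] := ltnP i k; first by rewrite e'.
  by apply: f; rewrite mem_iota ki.
move=> [e f]; split; apply/eq_in_map => i; rewrite mem_iota ?add0n => /andP[_ ik].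
  by rewrite e.
exact: f.
Qed.

Lemma gcyl_self k r z : gcyl k r z z.
Proof. by split. Qed.

Lemma eq_wd k l z w : gcyl k (k + l) z w -> wd k l w = wd k l z.
Proof.
rewrite -cyl_wd /cyl /wd /=; rewrite !size_map !size_iota => -[e f].
by congr pair.
Qed.

Lemma fdep_gcyl k r n z : (k <= n)%N -> (r <= n)%N -> fdep n (gcyl k r z).
Proof.
move=> kn rn u v uv; apply/propext; split=> -[h1 h2]; split=> i ik.
- by rewrite -uv ?h1// (leq_trans ik).
- by rewrite -uv ?h2// (leq_trans ik).
- by rewrite uv ?h1// (leq_trans ik).
- by rewrite uv ?h2// (leq_trans ik).
Qed.

Definition updx z k (a : letter m1) : Sigma m1 m2 := upd z k (a, (z k).2).
Definition updy z k (b : letter m2) : Sigma m1 m2 := upd z k ((z k).1, b).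

Lemma upd_id z k : upd z k (z k) = z.
Proof. by apply/funext => i; rewrite /upd; case: eqP => [->|]. Qed.

Lemma updx_snd z k a i : (updx z k a i).2 = (z i).2.
Proof. by rewrite /updx /upd; case: eqP => [->|]. Qed.

Lemma agree_updx z k a : agree k z (updx z k a).
Proof. by move=> i ik; rewrite /updx /upd ltn_eqF. Qed.

Lemma gcyl_updx k r z a :
  gcyl k r (updx z k a) = gcyl k r z.
Proof.
apply/seteqP; split=> w [h1 h2]; split=> i ik.
- by rewrite (agree_updx z a ik) h1.
- by rewrite h2// updx_snd.
- by rewrite -(agree_updx z a ik) h1.
- by rewrite h2// updx_snd.
Qed.

Lemma gcylS_updx k r z a : (k < r)%N ->
  gcyl k.+1 r (updx z k a) = gcyl k r z `&` [set w | (w k).1 = a].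
Proof.
move=> kr; apply/seteqP; split=> w.
  move=> [h1 h2]; split; last by rewrite /= -h1// /updx /upd eqxx.
  rewrite -(gcyl_updx _ _ _ a); split=> // i ik.
  exact: h1 (ltnW _).
move=> [h] /= wa; move: (h); rewrite -(gcyl_updx _ _ _ a) => -[h1 h2].
split=> // i; rewrite ltnS leq_eqVlt => /orP[/eqP ->|]; last exact: h1.
rewrite [RHS]surjective_pairing wa (h2 _ kr) updx_snd.
by rewrite /updx /upd eqxx.
Qed.

Lemma gcyl_updy r z b :
  gcyl 0 r.+1 (updy z r b) = gcyl 0 r z `&` [set w | (w r).2 = b].
Proof.
apply/seteqP; split=> w.
  move=> [_ h]; split; last by rewrite /= h// /updy /upd eqxx.
  split=> // i ir; rewrite h 1?ltnW// /updy /upd ltn_eqF//.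
move=> [[_ h] /= wb]; split=> // i; rewrite ltnS leq_eqVlt => /orP[/eqP ->|ir].
  by rewrite wb /updy /upd eqxx.
by rewrite h// /updy /upd ltn_eqF.
Qed.

Lemma wd_updx k l z a :
  (rcons (wd k l.+1 z).1 (a, (z k).2), [seq (z i).2 | i <- iota k.+1 l]) =
  wd k.+1 l (updx z k a).
Proof.
rewrite /wd; congr pair.
  rewrite -[k.+1]addn1 iotaD map_cat /= cats1.
  congr rcons; last by rewrite /updx /upd eqxx.
  apply/eq_in_map => i; rewrite mem_iota => /= ik.
  by rewrite /updx /upd ltn_eqF.
by apply/eq_in_map => i _; rewrite updx_snd.
Qed.

Definition yl (s : nat) z : seq (letter m2) := [seq (z i).2 | i <- iota 0 s].

Lemma ylS s z : yl s.+1 z = rcons (yl s z) (z s).2.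
Proof. by rewrite /yl -[s.+1]addn1 iotaD map_cat /= cats1. Qed.

Lemma yl_updy s z b : yl s.+1 (updy z s b) = rcons (yl s z) b.
Proof.
rewrite ylS; congr rcons; last by rewrite /updy /upd eqxx.
apply/eq_in_map => i; rewrite mem_iota => /= ik.
by rewrite /updy /upd ltn_eqF.
Qed.

Lemma size_yl s z : size (yl s z) = s.
Proof. by rewrite size_map size_iota. Qed.

Variable Omega : set (Sigma m1 m2).

Lemma is_prefix_wd k l z : is_prefix Omega (wd k l z) <->
  exists2 x, Omega x & gcyl k (k + l) z x.
Proof. by rewrite /is_prefix cyl_wd; split=> [[x []]|[x]]; exists x. Qed.

Lemma is_prefix_eq k l u : size u.1 = k -> size u.2 = l -> is_prefix Omega u ->
  exists2 x, Omega x & u = wd k l x.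
Proof.
move=> <- <- [x [Ox [e f]]]; exists x => //.
by rewrite [LHS]surjective_pairing; congr pair.
Qed.

Lemma Omega_prefix k l z : Omega z -> is_prefix Omega (wd k l z).
Proof. by move=> Oz; apply/is_prefix_wd; exists z => //; exact: gcyl_self. Qed.

End GeneralizedCylinders.

Lemma powR_expR (R : realType) (a x : R) : 0 < a -> a `^ x = expR (x * ln a).
Proof. by move=> a0; rewrite /powR gt_eqF. Qed.

Lemma expR_sum (R : realType) (I : Type) (r : seq I) (F : I -> R) :
  \prod_(i <- r) expR (F i) = expR (\sum_(i <- r) F i).
Proof.
by apply: (big_rec2 (fun a b => a = expR b)) => [|i a b _ ->];
  rewrite ?expR0// expRD.
Qed.

Lemma sum_predn (R : realType) n (F : nat -> R) : (0 < n)%N ->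
  \sum_(0 <= l < n) F l = \sum_(0 <= l < n.-1) F l + F n.-1.
Proof. by case: n => // n _; rewrite big_nat_recr. Qed.

(** * Logarithm of the chain measure on generalized cylinders *)

Section ChainMeasure.
Variables (R : realType) (q m1 m2 j : nat).
Variables (Omega : set (Sigma m1 m2)) (t : word m1 m2 -> R).
Hypotheses (hq : (2 <= q)%N) (hOmega0 : Omega !=set0).
Hypothesis ht : is_t q j Omega t.

Let g := gamma R m1 m2.
Let alpha : R := (q ^ j)%:R * g.
Let qR0 : 0 < q%:R :> R. Proof. by rewrite ltr0n ltnW. Qed.
Implicit Types (z w x : Sigma m1 m2).

(** The index l starts from 0: the next three values are t at a word with l + 1 full letters, the
    inner sum over x'_(l+1), and S_(l+1). *)
Definition tval z l : R := t (wd l.+1 j z).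
Definition xval z l : R :=
  xsum Omega t (wd l j.+1 z).1 (wd l j.+1 z).2.
Definition sval z l : R := nestS q j Omega t (yl l.+1 z).

Lemma xvalE z l : xval z l =
  \sum_(a : letter m1 | `[< is_prefix Omega (wd l.+1 j (updx z l a)) >])
    tval (updx z l a) l.
Proof.
rewrite /xval /xsum /=; apply: eq_big => [a|a _]; rewrite /tval.
  by rewrite -wd_updx.
by rewrite -wd_updx.
Qed.

(** Every prefix of Omega with a full letter is reached from its own first window by followers, so
    [is_t] controls t on all of them. *)
Lemma descendant_wd z k : Omega z -> descendant Omega (wd 1 j z) (wd k.+1 j z).
Proof.
move=> Oz; elim: k => [|k IH]; first exact: descendant_self.
apply: (descendant_follower IH).
exists (z k.+1).1, (z k.+1).2, (z (k.+1 + j)%N).2,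
  [seq (z i).2 | i <- iota k.+2 j]; split.
- rewrite /wd /= -[RHS]/[seq (z i).2 | i <- iota k.+1 j.+1].
  by rewrite -[j.+1]addn1 iotaD map_cat cats1.
- rewrite -surjective_pairing /wd; congr pair.
  by rewrite -[k.+2]addn1 iotaD map_cat /= cats1.
- exact: Omega_prefix.
Qed.

Definition tbound : R := m2%:R `^ (2 / (g * (q%:R - 1))).

Lemma tval_bounds z l : is_prefix Omega (wd l.+1 j z) -> 1 <= tval z l <= tbound.
Proof.
move=> /is_prefix_wd[x Ox xz].
have [] := ht _ (descendant_wd l Ox).
  by split; [rewrite size_map|rewrite size_map size_iota|exact: Omega_prefix].
by rewrite (eq_wd xz).
Qed.

Lemma tbound_ge1 : 1 <= tbound.
Proof.
have [z Oz] := hOmega0; have /andP[] := tval_bounds (Omega_prefix 1 j Oz).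
exact: le_trans.
Qed.

(** One admissible letter is enough for the lower bound 1, which therefore survives every level of
    the nested sums. *)
Lemma sum_prefix_bounds (F : finType) (p : pred F) (f : F -> R) (B : R) (a : F) :
  p a -> (forall b, p b -> 1 <= f b <= B) -> 1 <= \sum_(b | p b) f b <= #|F|%:R * B.
Proof.
move=> pa h; have B0 : 0 <= B by have /andP[? ?] := h a pa; lra.
apply/andP; split.
  rewrite (bigD1 a)//= -[leLHS]addr0 lerD//; first by case/andP: (h a pa).
  by apply: sumr_ge0 => b /andP[pb _]; have /andP[? ?] := h b pb; lra.
apply: (@le_trans _ _ (\sum_(b | p b) B)).
  by apply: ler_sum => b pb; case/andP: (h b pb).
rewrite sumr_const -[leLHS]mulr_natl ler_wpM2r// ler_nat.
exact: max_card.
Qed.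

Lemma xval_bounds z l : Omega z -> 1 <= xval z l <= #|{: letter m1}|%:R * tbound.
Proof.
move=> Oz; rewrite xvalE; apply: (@sum_prefix_bounds _ _ _ _ (z l).1).
  by apply/asboolP; rewrite /updx -surjective_pairing upd_id; exact: Omega_prefix.
by move=> a /asboolP; exact: tval_bounds.
Qed.

Lemma alpha_ge0 : 0 <= alpha.
Proof.
have h n : 0 <= ln n%:R :> R.
  by case: n => [|n]; [rewrite ln0|rewrite ln_ge0// ler1n].
by rewrite mulr_ge0// /g /gamma divr_ge0.
Qed.

Lemma powR_bounds (a B e : R) : 0 <= e -> 1 <= a <= B -> 1 <= a `^ e <= B `^ e.
Proof.
move=> e0 /andP[a1 aB]; rewrite -{1}(powRr0 a).
apply/andP; split; first by rewrite ler_powR.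
by apply: ge0_ler_powR; rewrite ?nnegrE//; lra.
Qed.

Lemma nestS_rec_bounds n : exists B, forall z s, Omega z -> (s + n = j.+1)%N ->
  1 <= nestS_rec q j Omega t n (yl s z) <= B.
Proof.
elim: n => [|n [B IH]].
  eexists => z s Oz; rewrite addn0 => ->.
  exact: (powR_bounds alpha_ge0 (xval_bounds 0 Oz)).
eexists => z s Oz sn /=; apply: powR_bounds; first by rewrite invr_ge0 ltW.
apply: (@sum_prefix_bounds _ _ _ _ (z s).2).
  by apply/asboolP; rewrite -ylS; exact: (@Omega_prefix _ _ _ 0).
move=> b /asboolP /(is_prefix_eq erefl erefl)[x Ox /= [e]].
rewrite -/(yl _ _) in e.
have -> : rcons (yl s z) b = yl s.+1 x by rewrite e size_rcons size_yl.
by apply: IH => //; rewrite addSnnS.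
Qed.

Lemma nestS_bounds s : exists B, forall z, Omega z -> (0 < s <= j.+1)%N ->
  1 <= nestS q j Omega t (yl s z) <= B.
Proof.
have [B HB] := nestS_rec_bounds (j.+1 - s); exists B => z Oz /andP[s0 sj].
by rewrite /nestS size_yl; apply: HB => //; rewrite subnKC.
Qed.

Lemma nestS_gt0 s z : Omega z -> (0 < s <= j.+1)%N ->
  0 < nestS q j Omega t (yl s z).
Proof.
move=> Oz sj; have [B /(_ z Oz sj)/andP[h _]] := nestS_bounds s.
exact: lt_le_trans ltr01 h.
Qed.

Lemma tval_gt0 z l : is_prefix Omega (wd l.+1 j z) -> 0 < tval z l.
Proof. by move=> /tval_bounds/andP[h _]; exact: lt_le_trans ltr01 h. Qed.

Lemma xval_gt0 z l : Omega z -> 0 < xval z l.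
Proof. by move=> /(xval_bounds l)/andP[h _]; exact: lt_le_trans ltr01 h. Qed.

Lemma yprefix s z b : is_prefix Omega ([::], rcons (yl s z) b) ->
  exists2 x, Omega x & rcons (yl s z) b = yl s.+1 x.
Proof.
move=> /(is_prefix_eq erefl erefl)[x Ox /= [e]]; exists x => //.
by rewrite e size_rcons size_yl.
Qed.

Lemma nestW_gt0 s z : Omega z -> (s <= j)%N -> 0 < nestW q j Omega t (yl s z).
Proof.
move=> Oz sj; rewrite /nestW (bigD1 (z s).2)/=; last first.
  by apply/asboolP; rewrite -ylS; exact: (@Omega_prefix _ _ _ 0).
rewrite ltr_pwDl//; first by rewrite -ylS; apply: nestS_gt0.
apply: sumr_ge0 => b /andP[/asboolP /yprefix[x Ox ->] _].
by apply/ltW/nestS_gt0.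
Qed.

Lemma nestSW s z : (0 < s <= j)%N ->
  nestS q j Omega t (yl s z) = nestW q j Omega t (yl s z) `^ (q%:R^-1).
Proof.
move=> /andP[s0 sj]; rewrite /nestS size_yl subSn//=.
congr (_ `^ _); apply: eq_bigr => b _.
by rewrite /nestS size_rcons size_yl subSS.
Qed.

Lemma t_empty_ge1 : 1 <= t_empty q j Omega t.
Proof.
have [z Oz] := hOmega0; rewrite /t_empty.
have [B HB] := nestS_bounds 1.
suff /andP[] : 1 <= \sum_(y : letter m2 | `[< is_prefix Omega ([::], [:: y]) >])
  nestS q j Omega t [:: y] <= #|{: letter m2}|%:R * B by [].
apply: (@sum_prefix_bounds _ _ _ _ (z 0%N).2).
  by apply/asboolP; exact: (@Omega_prefix _ _ _ 0 1).
move=> b /asboolP /(@yprefix 0 z)[x Ox /= ->].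
exact: HB.
Qed.

Definition tlog z l : R := ln (tval z l).
Definition xlog z l : R := ln (xval z l).
(* S_{l+1} for l < j; extended by 0 in order to sum over all l. *)
Definition slog z l : R := if (l < j)%N then ln (sval z l) else 0.

(** The truncated subtractions are intended: for r <= j the ranges r - j - 1 and r - j are empty and
    only the nested sums remain, so one formula serves short and long chains. *)
Definition chain_log (k r : nat) z : R :=
  \sum_(0 <= l < k) tlog z l - \sum_(0 <= l < k) xlog z l
  - q%:R * alpha * \sum_(0 <= l < r - j.+1) tlog z l
  + alpha * \sum_(0 <= l < r - j) xlog z l
  + \sum_(0 <= l < r) slog z l - q%:R * \sum_(0 <= l < r.-1) slog z l
  - ln (t_empty q j Omega t).

Lemma window_wd k z p : (p <= k)%N -> window j (wd k j z) p = wd p j z.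
Proof.
move=> pk; rewrite /window /yword /wd /= -map_take take_iota (minn_idPl pk).
congr pair; rewrite -map_comp -[X in X ++ _]/[seq (z i).2 | i <- iota 0 k].
rewrite -map_cat -iotaD -map_drop drop_iota -map_take take_iota add0n.
by rewrite (minn_idPl _)// leq_subRL ?leq_add2r// (leq_trans pk) ?leq_addr.
Qed.

Lemma yword_take k z s : (s <= k + j)%N -> take s (yword (wd k j z)) = yl s z.
Proof.
move=> sk; rewrite /yword /wd /= -map_comp.
rewrite -[X in X ++ _]/[seq (z i).2 | i <- iota 0 k].
by rewrite -map_cat -iotaD -map_take take_iota (minn_idPl sk).
Qed.

Lemma mu_num_wd k z p : (p < k)%N ->
  mu_num q j Omega t (wd k j z) p.+1 = tval z p * xval z p `^ (alpha - 1).
Proof.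
move=> pk; rewrite /mu_num window_wd//; congr (_ * _ `^ _).
rewrite /xval; congr (xsum _ _ _ _).
  by rewrite /wd /= -map_take take_iota (minn_idPl (ltnW pk)).
rewrite /yword /wd /= -map_comp.
rewrite -[X in X ++ _]/[seq (z i).2 | i <- iota 0 k].
rewrite -map_cat -iotaD -map_drop drop_iota -map_take take_iota add0n.
rewrite (minn_idPl _)// leq_subRL; last by rewrite (leq_trans (ltnW pk)) ?leq_addr.
by rewrite addnS -addSn leq_add2r.
Qed.

(** The logarithm of [mu_formula] at k + 1 full letters without its factor [tval z k]. It does not
    involve the first coordinate of letter k + 1, so summing over that coordinate merely replaces
    [tval] by [xval]. *)
Definition head_log k z : R :=
  \sum_(0 <= l < k) tlog z l + (alpha - 1) * \sum_(0 <= l < k.+1) xlog z l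
  - q%:R * alpha * \sum_(0 <= l < k) tlog z l - ln (t_empty q j Omega t)
  + (1 - q%:R) * \sum_(0 <= l < j) slog z l.

Lemma tvalK z l : Omega z -> tval z l = expR (tlog z l).
Proof. by move=> Oz; rewrite /tlog lnK// posrE tval_gt0//; exact: Omega_prefix. Qed.

Lemma xvalK z l : Omega z -> xval z l = expR (xlog z l).
Proof. by move=> Oz; rewrite /xlog lnK// posrE xval_gt0. Qed.

Lemma nestW_log z l : Omega z -> (l < j)%N ->
  ln (nestW q j Omega t (yl l.+1 z)) = q%:R * slog z l.
Proof.
move=> Oz lj; rewrite /slog lj /sval nestSW ?lj// ln_powR mulrA divff ?mul1r//.
by rewrite gt_eqF.
Qed.

Lemma mu_formula_wd k z : Omega z ->
  mu_formula q j Omega t (wd k.+1 j z) = tval z k * expR (head_log k z).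
Proof.
move=> Oz; rewrite /mu_formula mu_num_wd//.
have -> : size (wd k.+1 j z).1 = k.+1 by rewrite size_map size_iota.
have -> : \prod_(0 <= p < j)
    nestW q j Omega t (take (j - p) (yword (wd k.+1 j z))) `^ ((1 - q%:R) / q%:R) =
    expR ((1 - q%:R) * \sum_(0 <= l < j) slog z l).
  (* Reversal sets l = j - 1 - p. As ln W_(l+1) = q ln S_(l+1), the exponent (1 - q)/q leaves (1 -
     q) ln S_(l+1). *)
  rewrite big_nat_rev mulr_sumr -expR_sum; apply: eq_big_nat => l /andP[_ lj].
  rewrite add0n subKn// yword_take; last first.
    by rewrite (leq_trans lj)// leq_addl.
  rewrite powR_expR ?nestW_gt0// nestW_log// mulrA -mulrA; congr expR.
  by rewrite mulrA divfK// gt_eqF.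
have -> : \prod_(2 <= p < k.+2) (mu_num q j Omega t (wd k.+1 j z) p /
    t (window j (wd k.+1 j z) p.-1) `^ ((q ^ j.+1)%:R * gamma R m1 m2)) =
  expR (\sum_(0 <= l < k) (tlog z l.+1 + (alpha - 1) * xlog z l.+1
     - q%:R * alpha * tlog z l)).
  rewrite -expR_sum (big_addn 0) !subSS subn0; apply: eq_big_nat => l /andP[_ lk].
  rewrite addn2 mu_num_wd ?ltnS// window_wd ?ltnS//; last exact: ltnW.
  rewrite -/(tval z l) !tvalK// xvalK// -!expRM -expRN -!expRD.
  by rewrite expnS natrM -mulrA -/alpha; congr expR; ring.
have t0 := lt_le_trans ltr01 t_empty_ge1.
rewrite -[t_empty q j Omega t]lnK// xvalK// !tvalK// -!expRM -expRN -!expRD.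
congr expR; rewrite /head_log big_split /= big_split /= sumrN -!mulr_sumr.
rewrite [\sum_(0 <= l < k.+1) xlog z l]big_nat_recl//.
suff : tlog z 0 + \sum_(0 <= i < k) tlog z i.+1 = tlog z k + \sum_(0 <= l < k) tlog z l.
  lra.
by rewrite -big_nat_recl// big_nat_recr//= addrC.
Qed.

Lemma gcyl_le k r k' r' z x : (k' <= k)%N -> (r' <= r)%N ->
  gcyl k r z x -> gcyl k' r' z x.
Proof.
move=> kk rr [h1 h2]; split=> i ik; [apply: h1|apply: h2].
  exact: leq_trans kk.
exact: leq_trans rr.
Qed.

Lemma head_log_eq k z x : gcyl k (k + j.+1) z x -> head_log k x = head_log k z.
Proof.
move=> h.
have eT : \sum_(0 <= l < k) tlog x l = \sum_(0 <= l < k) tlog z l.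
  apply: eq_big_nat => l /andP[_ lk]; rewrite /tlog /tval.
  rewrite (@eq_wd _ _ _ _ z)//; apply: gcyl_le h => //.
  by rewrite addSnnS leq_add2r ltnW.
have eX : \sum_(0 <= l < k.+1) xlog x l = \sum_(0 <= l < k.+1) xlog z l.
  apply: eq_big_nat => l /andP[_ lk]; rewrite /xlog /xval.
  by rewrite (@eq_wd _ _ _ _ z)//; apply: gcyl_le h => //; rewrite leq_add2r.
have eS : \sum_(0 <= l < j) slog x l = \sum_(0 <= l < j) slog z l.
  apply: eq_big_nat => l /andP[_ lj]; rewrite /slog /sval.
  congr (if _ then ln (nestS _ _ _ _ _) else _); apply/eq_in_map => i; rewrite mem_iota add0n => /andP[_ il]; apply: h.2.
  rewrite (leq_trans il)// (leq_trans lj)//.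
  by rewrite (leq_trans (leqnSn _)) ?leq_addl.
by rewrite /head_log eT eX eS.
Qed.

Variable mu : probability (SigmaB m1 m2) R.
Hypothesis hOmega : closed Omega.
Hypothesis hmu : is_mu q j Omega t mu.

Local Notation m A := (fine (mu A)).

(** Such a cylinder misses Omega, which has full measure. This supplies the values of mu on which
    the explicit formula is silent. *)
Lemma mu_not_prefix k l z : ~ is_prefix Omega (wd k l z) ->
  m (gcyl k (k + l) z) = 0.
Proof.
move=> np; have mO : measurable (Omega : set (SigmaB m1 m2)).
  rewrite -(setCK Omega); apply: measurableC; apply: sub_sigma_algebra.
  by rewrite openC.
have mG : measurable (gcyl k (k + l) z : set (SigmaB m1 m2)).
  by apply: (@measurable_fdep _ _ (k + l)); apply: fdep_gcyl => //; exact: leq_addr.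
apply/eqP; rewrite eq_le fine_measure_ge0 andbT.
apply: le_trans (le_fine_measure _ mG (measurableC mO) _) _.
  by move=> x Gx Ox; apply: np; apply/is_prefix_wd; exists x.
by rewrite probability_setC// hmu.1 subee.
Qed.

Lemma mu_updx k z a : Omega z ->
  m (gcyl k.+1 (k.+1 + j) (updx z k a)) =
  if `[< is_prefix Omega (wd k.+1 j (updx z k a)) >]
  then tval (updx z k a) k * expR (head_log k z) else 0.
Proof.
move=> Oz; case: asboolP => [pr|]; last exact: mu_not_prefix.
(* The modified sequence need not lie in Omega; the formula is evaluated at a point of Omega with
   the same prefix. *)
have [x Ox xz] := (is_prefix_wd _ _ _ _).1 pr.
rewrite -cyl_wd (hmu.2 k.+1)//; last first.
  by split; rewrite ?size_map ?size_iota.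
rewrite /= -(eq_wd xz) mu_formula_wd// /tval (eq_wd xz) (@head_log_eq k z)//.
by move: xz; rewrite gcylS_updx ?addSn ?ltnS ?leq_addr// addnS => -[].
Qed.

Lemma mu_full k z : Omega z ->
  m (gcyl k.+1 (k.+1 + j) z) = expR (tlog z k + head_log k z).
Proof.
move=> Oz; have := mu_updx k (z k).1 Oz.
rewrite /updx -surjective_pairing upd_id asboolT; last exact: Omega_prefix.
by rewrite tvalK// -expRD.
Qed.

Lemma mu_ext k z : Omega z ->
  m (gcyl k (k + j.+1) z) = expR (xlog z k + head_log k z).
Proof.
move=> Oz; rewrite (@measure_split _ _ _ _ (fun w => (w k).1) _ _ k.+1); last 2 first.
- by move=> u w uw; rewrite uw.
- apply: (@measurable_fdep _ _ (k + j.+1)); apply: fdep_gcyl => //.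
  exact: leq_addr.
rewrite expRD -xvalK// xvalE mulr_suml [RHS]big_mkcond /=; apply: eq_bigr => a _.
by rewrite -gcylS_updx ?addnS ?ltnS ?leq_addr// -addSn mu_updx.
Qed.

(* By induction on j + 1 - r: since nestW = nestS ^ q, summing over the last
   second coordinate turns nestS (y_1..y_{r+1}) into nestS (y_1..y_r) times
   nestW ^ ((1 - q) / q). *)
Lemma mu_second z n r : Omega z -> (0 < r)%N -> (r + n = j.+1)%N ->
  m (gcyl 0 r z) = nestS q j Omega t (yl r z) *
    expR ((1 - q%:R) * \sum_(0 <= l < r.-1) slog z l - ln (t_empty q j Omega t)).
Proof.
elim: n z r => [|n IH] z r Oz r0.
  rewrite addn0 => ->; rewrite -[j.+1]add0n mu_ext// add0n /= expRD.
  rewrite /nestS size_yl subnn /= powR_expR; last exact: (xval_gt0 0).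
  rewrite -!expRD; congr expR.
  rewrite /head_log big_nat1 !(@big_geq _ _ _ 0 0)// -/(xval z 0) -/(xlog z 0) -/g -/alpha.
  ring.
move=> rn; have rj : (r <= j)%N by rewrite -ltnS -rn addnS ltnS leq_addr.
rewrite (@measure_split _ _ _ _ (fun w => (w r).2) _ _ r.+1); last 2 first.
- by move=> u w uw; rewrite uw.
- by apply: (@measurable_fdep _ _ r); exact: fdep_gcyl.
have sW : nestS q j Omega t (yl r z) =
    expR (slog z r.-1).
  rewrite /slog prednK// rj lnK ?/sval ?prednK// posrE nestS_gt0// r0.
  by rewrite (leq_trans rj).
have eW : nestW q j Omega t (yl r z) = expR (q%:R * slog z r.-1).
  by rewrite -nestW_log ?prednK// lnK// posrE nestW_gt0.
transitivity (nestW q j Omega t (yl r z) *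
    expR ((1 - q%:R) * \sum_(0 <= l < r) slog z l - ln (t_empty q j Omega t))); last first.
  rewrite eW sW -!expRD; congr expR.
  rewrite (@sum_predn _ r (slog z))//; ring.
rewrite /nestW mulr_suml [RHS]big_mkcond /=; apply: eq_bigr => b _.
rewrite -gcyl_updy; case: asboolP => [|np]; last first.
  apply: (@mu_not_prefix 0 r.+1); move: np; rewrite -yl_updy.
  exact.
move=> /yprefix[x Ox e]; rewrite e.
have -> : gcyl 0 r.+1 (updy z r b) = gcyl 0 r.+1 x.
  have e' : yl r.+1 (updy z r b) = yl r.+1 x by rewrite yl_updy.
  have {}e' i : (i < r.+1)%N -> (updy z r b i).2 = (x i).2.
    by move=> ir; move/eq_in_map: e'; apply; rewrite mem_iota.
  by apply/seteqP; split=> w [_ h]; split=> // i ir; rewrite h// e'.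
rewrite (IH x r.+1 Ox isT) ?addSnnS//.
suff -> : \sum_(0 <= l < r) slog z l = \sum_(0 <= l < r) slog x l by [].
apply: eq_big_nat => l /andP[_ lr]; rewrite /slog /sval.
congr (if _ then ln (nestS _ _ _ _ _) else _).
apply/eq_in_map => i; rewrite mem_iota add0n => /andP[_ il].
have /(congr1 (take r)) := e; rewrite -cats1 take_size_cat ?size_yl//.
rewrite /yl -map_take take_iota (minn_idPl (leqnSn _)) => /eq_in_map ->//.
by rewrite mem_iota (leq_trans il).
Qed.

(** The range of k leaves three shapes: r <= j with k = 0, then r = k + j + 1, and r = k + j with k
    > 0. In the last two the sums of [slog] stop at j, where it vanishes. *)
Lemma chain_measure k r z : Omega z -> (0 < r)%N ->
  (r - j.+1 <= k <= r - j)%N -> m (gcyl k r z) = expR (chain_log k r z).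
Proof.
move=> Oz r0 /andP[k1 k2]; rewrite /chain_log.
have slog_j n : (j <= n)%N -> \sum_(0 <= l < n) slog z l = \sum_(0 <= l < j) slog z l.
  move=> jn; rewrite (big_cat_nat (leq0n _) jn)//= [X in _ + X]big_nat_cond.
  rewrite [X in _ + X]big1 ?addr0// => l; rewrite andbT => /andP[jl _].
  by rewrite /slog ltnNge jl.
have [rj|rj] := leqP r j.
  have k0 : k = 0%N by apply/eqP; rewrite -leqn0 (leq_trans k2)// leqn0 subn_eq0.
  rewrite k0 (@mu_second z (j.+1 - r))// ?subnKC// 1?leqW//.
  have -> : nestS q j Omega t (yl r z) = expR (slog z r.-1).
    rewrite /slog prednK// rj lnK ?/sval ?prednK// posrE nestS_gt0// r0.
    by rewrite (leq_trans rj).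
  rewrite -expRD; congr expR.
  have -> : (r - j.+1 = 0)%N by lia.
  have -> : (r - j = 0)%N by lia.
  rewrite (@sum_predn _ r (slog z))// !(@big_geq _ _ _ 0 0)//; ring.
have [e|e] : r = (k + j.+1)%N \/ exists2 k', k = k'.+1 & r = (k + j)%N.
- case: k k1 k2 => [|k] k1 k2; first by left; lia.
  have [->|?] := eqVneq r (k.+1 + j)%N; [by right; exists k|left; lia].
- rewrite e mu_ext//; congr expR.
  have -> : (k + j.+1 - j.+1 = k)%N by lia.
  have -> : (k + j.+1 - j = k.+1)%N by lia.
  have -> : (k + j.+1).-1 = (k + j)%N by lia.
  rewrite /head_log (slog_j (k + j)%N) ?leq_addl// (slog_j (k + j.+1)%N); last lia.
  rewrite !big_nat_recr//=; ring.
case: e => k' ek er; rewrite er ek mu_full//; congr expR.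
have -> : (k'.+1 + j - j.+1 = k')%N by lia.
have -> : (k'.+1 + j - j = k'.+1)%N by lia.
have -> : (k'.+1 + j).-1 = (k' + j)%N by lia.
rewrite /head_log (slog_j (k' + j)%N) ?leq_addl// (slog_j (k'.+1 + j)%N) ?leq_addl//.
rewrite [\sum_(0 <= l < k'.+1) tlog z l]big_nat_recr//=; ring.
Qed.

End ChainMeasure.

(** * The measure of balls *)

Section ChainSums.
Variables (R : realType) (q m1 m2 : nat).
Hypothesis hq : (2 <= q)%N.
Implicit Types (z w x : Sigma m1 m2).

Let q_gt0 : (0 < q)%N. Proof. exact: ltnW. Qed.

(** Although grouped by chains, this has exactly one term for each position i q^l <= n. *)
Definition csum (c : Sigma m1 m2 -> nat -> R) z (n : nat) : R :=
  \sum_(i <- heads q n) \sum_(0 <= l < cnt q i n) c (subseq_at q i z) l.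

(** Chains starting after n contribute empty sums. Sums with different cutoffs can thus be compared
    chain by chain. *)
Lemma csum_wide c z n M : (n <= M)%N ->
  csum c z n = \sum_(i <- heads q M) \sum_(0 <= l < cnt q i n) c (subseq_at q i z) l.
Proof.
move=> nM; rewrite /csum /heads [RHS]big_filter.
have nM' : (n.+1 <= M.+1)%N by [].
rewrite [RHS](big_cat_nat _ nM')//= big_filter -[LHS]addr0; congr (_ + _).
rewrite big_nat_cond big1// => i /andP[/andP[ni _] _].
rewrite big_geq// leqNgt (cntP hq); last exact: leq_ltn_trans ni.
by rewrite expn0 muln1 -ltnNge.
Qed.

Lemma csum0 c z : csum c z 0 = 0.
Proof. by rewrite /csum /heads /index_iota big_nil. Qed.

(** The position n + 1 lies in exactly one chain. *)
Lemma csumS c z n : exists i l, [/\ (0 < i)%N, ~~ (q %| i)%N &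
  csum c z n.+1 = csum c z n + c (subseq_at q i z) l].
Proof.
have [i0 [l0 [i00 qi0 e]]] := qdecomp hq (ltn0Sn n).
exists i0, l0; split=> //.
have i0in : i0 \in heads q n.+1.
  by rewrite mem_heads i00 qi0 andbT /= e leq_pmulr// expn_gt0 q_gt0.
have [c0 c1] := cntS_eq hq i00 e.
rewrite (csum_wide _ _ (leqnSn n)) /csum.
rewrite (bigD1_seq i0) ?uniq_heads//= [in RHS](bigD1_seq i0) ?uniq_heads//=.
rewrite c0 c1 big_nat_recr//= addrAC; congr (_ + _ + _).
rewrite big_seq_cond [RHS]big_seq_cond.
apply: eq_bigr => i /andP[]; rewrite mem_heads => /and3P[ig0 _ qi] ii0.
rewrite cntS_neq// => l.
apply/eqP; rewrite e => /(qdecomp_uniq hq i00 qi0 qi)[ee _].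
by rewrite ee eqxx in ii0.
Qed.

Lemma size_heads M : (size (heads q M) + M %/ q = M)%N.
Proof.
elim: M => [|M IH]; first by rewrite div0n.
have -> : heads q M.+1 = heads q M ++ [seq i <- [:: M.+1] | ~~ (q %| i)%N].
  rewrite /heads /index_iota !subSS !subn0 -filter_cat.
  by have := iotaD 1 M 1; rewrite addn1 add1n => ->.
rewrite size_cat divnS//= -[in RHS]IH.
by case: (q %| M.+1)%N => /=; lia.
Qed.

Lemma size_heads_bounds M :
  (q%:R - 1) / q%:R * M%:R <= (size (heads q M))%:R :> R /\
  (size (heads q M))%:R <= (q%:R - 1) / q%:R * M%:R + 1 :> R.
Proof.
have q0 : 0 < q%:R :> R by rewrite ltr0n.
have e : (size (heads q M))%:R = M%:R - (M %/ q)%:R :> R.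
  by rewrite -[in M%:R](size_heads M) natrD addrK.
have h1 : (M %/ q)%:R * q%:R <= M%:R :> R by rewrite -natrM ler_nat leq_divM.
have h2 : M%:R <= (M %/ q)%:R * q%:R + q%:R :> R.
  rewrite -natrM -natrD ler_nat {1}(divn_eq M q) leq_add2l.
  by rewrite ltnW// ltn_pmod.
rewrite e; move: h1 h2; move: (M %/ q)%:R M%:R => a b h1 h2.
have -> : (q%:R - 1) / q%:R * b = b - b / q%:R.
  by rewrite mulrBl mul1r divff ?gt_eqF// mulrBl mul1r [_^-1 * _]mulrC.
have h3 : a <= b / q%:R by rewrite ler_pdivlMr.
have h4 : b / q%:R <= a + 1 by rewrite ler_pdivrMr// mulrDl mul1r.
by split; lra.
Qed.

End ChainSums.

Section LogBallMeasure.
Variables (R : realType) (q m1 m2 j : nat).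
Variables (Omega : set (Sigma m1 m2)) (t : word m1 m2 -> R).
Variables (mu P : probability (SigmaB m1 m2) R).
Hypotheses (hq : (2 <= q)%N) (hm2 : (2 <= m2)%N) (hm : (m2 < m1)%N).
Hypothesis hj : (q ^ j)%:R <= (gamma R m1 m2)^-1 < (q ^ j.+1)%:R.
Hypotheses (hOmega0 : Omega !=set0) (hOmega : closed Omega).
Hypotheses (ht : is_t q j Omega t) (hmu : is_mu q j Omega t mu).
Hypothesis hP : is_P q mu P.
Implicit Types (z w x : Sigma m1 m2).

Let g := gamma R m1 m2.
Let L := Lnat R m1 m2.
Let q_gt0 : (0 < q)%N. Proof. exact: ltnW. Qed.

Lemma gamma_gt0 : 0 < g.
Proof.
rewrite /g /gamma divr_gt0// ln_gt0// ltr1n//.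
exact: leq_ltn_trans (ltnW hm2) hm.
Qed.

Lemma gamma_le1 : g <= 1.
Proof.
have m10 : (0 < m1)%N by exact: leq_ltn_trans hm.
rewrite /g /gamma ler_pdivrMr ?mul1r.
  by rewrite ler_ln ?posrE ?ltr0n// ?ler_nat 1?ltnW// ltnW.
by rewrite ln_gt0// ltr1n (leq_ltn_trans (ltnW hm2) hm).
Qed.

Lemma LnatP k n : (k < L n)%N = (g * k%:R < n%:R).
Proof.
have g0 := gamma_gt0.
have h : 0 <= Num.ceil (n%:R / g).
  by rewrite ceil_ge0 (lt_le_trans (ltrN10 R))// divr_ge0// ltW.
rewrite /L /Lnat -/g -ltz_nat gez0_abs// ceil_gt_int ltr_pdivlMr//.
by rewrite mulrC pmulrn.
Qed.

(** Together with [Ldiv_leq], this is how the choice of j enters: by [cnt_divn], a chain with r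
    letters up to L n has between r - j - 1 and r - j letters up to n. *)
Lemma leq_Ldiv n : (n <= L n %/ q ^ j)%N.
Proof.
rewrite leq_divRL ?expn_gt0 ?q_gt0//; case: n => // n.
have -> : (n.+1 * q ^ j = (n.+1 * q ^ j).-1.+1)%N.
  by rewrite prednK// muln_gt0 expn_gt0 q_gt0.
rewrite LnatP; have /andP[h _] := hj; have g0 := gamma_gt0.
apply: lt_le_trans (_ : g * (n.+1 * q ^ j)%:R <= _).
  by rewrite ltr_pM2l// ltr_nat prednK// muln_gt0 expn_gt0 q_gt0.
rewrite natrM mulrCA -[leRHS]mulr1 ler_wpM2l//.
by rewrite mulrC -ler_pdivlMr// mul1r.
Qed.

Lemma Ldiv_leq n : (L n %/ q ^ j.+1 <= n)%N.
Proof.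
have /andP[_ h] := hj; have g0 := gamma_gt0.
suff : (L n <= n * q ^ j.+1)%N.
  have Q0 : (0 < q ^ j.+1)%N by rewrite expn_gt0 q_gt0.
  by move=> h'; rewrite -[leqRHS](mulnK n Q0) leq_div2r.
rewrite leqNgt LnatP natrM -leNgt mulrCA -[leLHS]mulr1 ler_wpM2l//.
by rewrite mulrC -ler_pdivrMr// mul1r ltW.
Qed.

Lemma BnE n z : Bn R n z = [set w | forall i, i \in heads q (L n) ->
  gcyl (cnt q i n) (cnt q i (L n)) (subseq_at q i z) (subseq_at q i w)].
Proof.
have nL : (n <= L n)%N := L_ge gamma_le1 LnatP n.
have pos i k : (0 < i)%N -> (0 < i * q ^ k)%N.
  by move=> i0; rewrite muln_gt0 i0 expn_gt0 q_gt0.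
apply/seteqP; split=> w /=.
  move=> [h1 h2] i /heads_gt0 i0; split=> k; rewrite cntP// => ik.
    rewrite /subseq_at [LHS]surjective_pairing [RHS]surjective_pairing.
    by rewrite h1 ?prednK ?pos// h2// prednK ?pos// (leq_trans ik).
  by rewrite /subseq_at h2// prednK ?pos.
move=> h.
have aux k (kL : (k < L n)%N) : exists i l,
    [/\ i \in heads q (L n), (0 < i)%N & k = (i * q ^ l).-1].
  have [i [l [i0 qi e]]] := qdecomp hq (ltn0Sn k).
  exists i, l; rewrite -e; split=> //; rewrite mem_heads i0 qi andbT /=.
  by apply: leq_trans kL; rewrite e leq_pmulr// expn_gt0 q_gt0.
split=> k kn.
  have [i [l [iL i0 e]]] := aux k (leq_trans kn nL).
  have [h1 _] := h _ iL; have := h1 l.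
  rewrite cntP// /subseq_at -e => -> //.
  by rewrite e prednK ?pos in kn.
have [i [l [iL i0 e]]] := aux k kn.
have [_ h2] := h _ iL; have := h2 l.
rewrite cntP// /subseq_at -e => -> //.
by rewrite e prednK ?pos in kn.
Qed.

(** The sum of the [chain_log] without the t_empty terms. In the last two differences the values at
    n cancel, leaving S(L n) - q S(L n / q) for the nested sums. *)
Definition ball_log z n : R :=
  (- 1) * Delta g L (q ^ j.+1) (csum q (tlog j t) z) n
  + Delta g L (q ^ j) (csum q (xlog j Omega t) z) n
  + (g^-1 * Delta g L 1 (csum q (slog q j Omega t) z) n
     + (- g^-1) * Delta g L q (csum q (slog q j Omega t) z) n).

Lemma fdep_Bn n z : fdep (L n) (Bn R n z).
Proof.
have nL : (n <= L n)%N := L_ge gamma_le1 LnatP n.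
move=> u v uv; apply/propext; split=> -[h1 h2]; split=> k kn.
- by rewrite -uv ?h1// (leq_trans kn).
- by rewrite -uv ?h2.
- by rewrite uv ?h1// (leq_trans kn).
- by rewrite uv ?h2.
Qed.

Lemma ball_measure z n : XOmega q Omega z ->
  P (Bn R n z) = (expR (ball_log z n -
    (size (heads q (L n)))%:R * ln (t_empty q j Omega t)))%:E.
Proof.
move=> Xz; have nL : (n <= L n)%N := L_ge gamma_le1 LnatP n.
rewrite measure_fineE; last exact: measurable_fdep (@fdep_Bn n z).
congr EFin; rewrite BnE (P_chains hq hP (C := fun i =>
  gcyl (cnt q i n) (cnt q i (L n)) (subseq_at q i z))); last first.
  by move=> i i0; apply: fdep_gcyl => //; exact: leq_cnt.
transitivity (\prod_(i <- heads q (L n)) expR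
   (chain_log q j Omega t (cnt q i n) (cnt q i (L n)) (subseq_at q i z))).
  rewrite big_seq [RHS]big_seq; apply: eq_bigr => i.
  rewrite mem_heads => /and3P[i0 iL qi].
  apply: (chain_measure hq hOmega0 ht hOmega hmu); first exact: Xz.
    by rewrite cntP// expn0 muln1.
  rewrite -!cnt_divn//; apply/andP; split; apply: leq_cnt => //.
    exact: Ldiv_leq.
  exact: leq_Ldiv.
rewrite expR_sum; congr expR; rewrite /chain_log.
have eD (c : Sigma m1 m2 -> nat -> R) s :
    csum q c z (L n %/ q ^ s) = \sum_(i <- heads q (L n))
    \sum_(0 <= l < cnt q i (L n) - s) c (subseq_at q i z) l.
  rewrite (csum_wide hq _ _ (leq_div _ _)) big_seq [RHS]big_seq.
  by apply: eq_bigr => i /heads_gt0 i0; rewrite cnt_divn.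
have e1 (c : Sigma m1 m2 -> nat -> R) : csum q c z (L n %/ q) = \sum_(i <- heads q (L n))
    \sum_(0 <= l < (cnt q i (L n)).-1) c (subseq_at q i z) l.
  by have := eD c 1%N; rewrite expn1 => ->; apply: eq_bigr => i _; rewrite subn1.
rewrite /ball_log /Delta !eD e1 divn1 !(csum_wide hq _ _ nL) /csum.
rewrite !(big_split, sumrN) /= -!mulr_sumr.
rewrite [\sum_(i <- _) ln _]big_const_seq count_predT iter_addr_0 -mulr_natl.
have g0 : g != 0 by rewrite gt_eqF// gamma_gt0.
rewrite -/g expnS natrM; move: (ln _) => lt.
by field.
Qed.

Lemma ln_norm_bound (a B : R) : 1 <= a <= B -> `|ln a| <= ln B.
Proof.
move=> /andP[a1 aB]; rewrite ger0_norm ?ln_ge0// ler_ln ?posrE//; lra.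
Qed.

Lemma logs_bounded : exists C, forall x, Omega x -> forall l,
  [/\ `|tlog j t x l| <= C, `|xlog j Omega t x l| <= C
     & `|slog q j Omega t x l| <= C].
Proof.
have [B HB] := choice (nestS_bounds hq ht).
pose b1 := ln (tbound R q m1 m2).
pose b2 := ln (#|{: letter m1}|%:R * tbound R q m1 m2).
pose b3 := \sum_(l < j) `|ln (B l.+1)|.
have b30 : 0 <= b3 by apply: sumr_ge0.
have b10 : 0 <= b1 by rewrite ln_ge0//; exact: (tbound_ge1 hOmega0 ht).
have h2 x l : Omega x -> `|xlog j Omega t x l| <= b2.
  by move=> Ox; apply: ln_norm_bound; exact: (xval_bounds ht).
have b20 : 0 <= b2 by have [x Ox] := hOmega0; exact: le_trans (h2 x 0%N Ox).
exists (b1 + b2 + b3) => x Ox l.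
have h1 : `|tlog j t x l| <= b1.
  by apply: ln_norm_bound; apply: (tval_bounds ht); exact: Omega_prefix.
have {}h2 := h2 x l Ox.
have h3 : `|slog q j Omega t x l| <= b3.
  rewrite /slog; case: ltnP => lj; last by rewrite normr0.
  rewrite /b3 (bigD1 (Ordinal lj))//= -[leLHS]addr0 lerD ?sumr_ge0//.
  apply: le_trans (ler_norm _); apply: ln_norm_bound.
  by apply: HB => //=; rewrite ltnS ltnW.
by split; lra.
Qed.

Lemma csum_step (c : Sigma m1 m2 -> nat -> R) z C n : XOmega q Omega z ->
  (forall x, Omega x -> forall l, `|c x l| <= C) ->
  `|csum q c z n.+1 - csum q c z n| <= C.
Proof.
move=> Xz h; have [i [l [i0 qi ->]]] := csumS hq c z n.
by rewrite addrAC subrr add0r; apply: h; exact: Xz.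
Qed.

Lemma ball_log_logbdd z : XOmega q Omega z -> logbdd (ball_log z).
Proof.
move=> Xz; have [C HC] := logs_bounded.
have hD (c : Sigma m1 m2 -> nat -> R) Q : (0 < Q)%N ->
    (forall x, Omega x -> forall l, `|c x l| <= C) ->
    logbdd (Delta g L Q (csum q c z)).
  move=> Q0 h; apply: (@Delta_logbdd _ _ _ gamma_gt0 gamma_le1 LnatP _ _ C) => //.
    exact: csum0.
  by move=> n; exact: csum_step.
apply: logbddD; first apply: logbddD; last apply: logbddD.
- apply: logbddZ; apply: hD; first by rewrite expn_gt0 q_gt0.
  by move=> x Ox l; have [] := HC x Ox l.
- apply: hD; first by rewrite expn_gt0 q_gt0.
  by move=> x Ox l; have [] := HC x Ox l.
- by apply: logbddZ; apply: hD => // x Ox l; have [] := HC x Ox l.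
- by apply: logbddZ; apply: hD => // x Ox l; have [] := HC x Ox l.
Qed.

Let t0 := t_empty q j Omega t.
Definition dimension : R := (q%:R - 1) / q%:R * (ln t0 / ln m2%:R).

Lemma ln_m2_gt0 : 0 < ln m2%:R :> R.
Proof. by rewrite ln_gt0// ltr1n. Qed.

Lemma ln_t0_ge0 : 0 <= ln t0.
Proof. by rewrite ln_ge0//; exact: (t_empty_ge1 hq hOmega0 ht). Qed.

Lemma local_dim_le z : XOmega q Omega z ->
  (limn_einf (fun n => - logE m2 (P (Bn R n z)) * ((L n)%:R^-1)%:E)
     <= dimension%:E)%E.
Proof.
move=> Xz; rewrite leNgt; apply/negP; rewrite limn_einf_lim.
set u := (u in einfs u) => Du.
have [n0 [e e0 h]] : exists n0, exists2 e : R, 0 < e &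
    forall n, (n0 <= n)%N -> ((dimension + e)%:E <= u n)%E.
  have := @ereal_nondecreasing_cvgn R (einfs u) (nondecreasing_einfs u).
  move=> /(@cvg_lim _ _) /= elim; rewrite elim// in Du.
  have [_ [n0 _ <-] Dn0] := ereal_sup_gt Du; exists n0.
  have [e [e0 le_e]] : exists e : R, 0 < e /\ ((dimension + e)%:E <= einfs u n0)%E.
    case: (einfs u n0) Dn0 => [r| |]//; last by exists 1; rewrite leey.
    by rewrite lte_fin => h; exists (r - dimension); rewrite subr_gt0 addrC subrK.
  exists e => // n nn0; apply: le_trans le_e _; apply: ereal_inf_lbound.
  by exists n.
(* Half of the margin e ln m2 pays for the ln t0 that comes from the + 1 in the count of chains; the
   threshold on n makes ln t0 at most that half times n. *)
have := @logbdd_not_neg R (ball_log z) (e * ln m2%:R / 2)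
   (maxn n0 (Num.truncn (ln t0 / (e * ln m2%:R / 2))).+1) (ball_log_logbdd Xz).
have m20 := ln_m2_gt0; have c0 : 0 < e * ln m2%:R / 2 by rewrite divr_gt0// mulr_gt0.
apply; first by [].
move=> n; rewrite geq_max => /andP[nn0 n1n].
have := h n nn0; rewrite /u ball_measure// /logE lne_EFin ?expR_gt0// expRK -/t0.
have L0 : 0 < (L n)%:R :> R.
  by rewrite ltr0n (leq_trans _ (L_ge gamma_le1 LnatP n))// (leq_ltn_trans _ n1n).
have [_ hs] := size_heads_bounds R hq (L n).
have nt : ln t0 <= e * ln m2%:R / 2 * n%:R.
  rewrite mulrC -ler_pdivrMr//; apply: ltW; apply: lt_le_trans (truncnS_gt _) _.
  by rewrite ler_nat.
have nL : n%:R <= (L n)%:R :> R by rewrite ler_nat (L_ge gamma_le1 LnatP n).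
rewrite -EFinM lee_fin ler_pdivlMr// -mulNr ler_pdivlMr//.
have -> : (dimension + e) * (L n)%:R * ln m2%:R =
   (q%:R - 1) / q%:R * (L n)%:R * ln t0 + e * (L n)%:R * ln m2%:R.
  have qn : q%:R != 0 :> R by rewrite pnatr_eq0 -lt0n q_gt0.
  have mn : ln m2%:R != 0 :> R by rewrite gt_eqF.
  by rewrite /dimension; field; rewrite ?qn ?mn.
move: hs nt nL; have t00 := ln_t0_ge0.
move: ((q%:R - 1) / q%:R * (L n)%:R) => A hs nt nL hh.
have k1 := ler_wpM2r t00 hs.
have k2 := ler_wpM2l (ltW c0) nL.
rewrite mulrDl mul1r in k1.
lra.
Qed.

End LogBallMeasure.

(** * Law of large numbers along the chains *)

(** From exp(-x) >= 1 - x one gets exp(x) <= 1/(1 - x), and (1 - x)(1 + x + 2 x^2) = 1 + x^2 (1 - 2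
    x). *)
Lemma expR_quad_le (R : realType) (x : R) : x <= 2^-1 -> expR x <= 1 + x + 2 * x ^+ 2.
Proof.
move=> x2; have h : 0 < 1 - x by lra.
have : expR x <= (1 - x)^-1.
  rewrite -[expR x]invrK -expRN lef_pV2 ?posrE ?expR_gt0//.
  exact: expR_ge1Dx.
move=> /le_trans; apply; rewrite -[leLHS]mul1r ler_pdivrMr// expr2.
have : 0 <= x * x * (1 - 2 * x) by rewrite mulr_ge0 -?expr2 ?sqr_ge0//; lra.
lra.
Qed.

Section AlmostSurely.
Variables (R : realType) (m1 m2 : nat) (P : probability (SigmaB m1 m2) R).

(** Stated by negligibility of the complement, so that events can be handled without a measurability
    proof. *)
Definition almost_surely (A : Sigma m1 m2 -> Prop) : Prop :=
  P.-negligible (~` [set z | A z] : set (SigmaB m1 m2)).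

Lemma almost_surelyS (A B : Sigma m1 m2 -> Prop) :
  (forall z, A z -> B z) -> almost_surely A -> almost_surely B.
Proof. by move=> AB; apply: negligibleS => z /= nB Az; apply: nB; exact: AB. Qed.

Lemma almost_surelyI (A B : Sigma m1 m2 -> Prop) :
  almost_surely A -> almost_surely B -> almost_surely (fun z => A z /\ B z).
Proof.
move=> hA hB; have := negligibleU hA hB; apply: negligibleS => z /= nAB.
by apply: contrapT => /not_orP[/contrapT a /contrapT b]; exact: nAB.
Qed.

Lemma almost_surely_foralln (A : nat -> Sigma m1 m2 -> Prop) :
  (forall n, almost_surely (A n)) -> almost_surely (fun z => forall n, A n z).
Proof.
move=> hA; have := negligible_bigcup hA; apply: negligibleS => z /= nA.
apply: contrapT => h; apply: nA => n; apply: contrapT => nAn.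
by apply: h; exists n.
Qed.

End AlmostSurely.

Section LawOfLargeNumbers.
Variables (R : realType) (q m1 m2 : nat).
Variables (mu P : probability (SigmaB m1 m2) R).
Hypotheses (hq : (2 <= q)%N) (hP : is_P q mu P).
Implicit Types (z w x : Sigma m1 m2).

Let q_gt0 : (0 < q)%N. Proof. exact: ltnW. Qed.

Definition hsum (h : Sigma m1 m2 -> R) z (n : nat) : R :=
  \sum_(i <- heads q n) h (subseq_at q i z).

Lemma fdep_hsum h r n : fdep r h -> fdep (n * q ^ r) (fun z => hsum h z n).
Proof.
move=> dh z w zw; rewrite /hsum big_seq [RHS]big_seq.
apply: eq_bigr => i; rewrite mem_heads => /and3P[i0 iI _].
apply: (fdep_subseq hq i0 _ zw); apply: fdep_le dh.
by apply: ltnW; rewrite (cntP hq)// leq_mul2r iI orbT.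
Qed.

(** Markov's inequality for exp(th hsum), whose expectation factors over the chains. The choice th =
    e / (4 B^2) minimises 2 th^2 B^2 - th e, with value - e^2 / (8 B^2); e <= 1 <= B keeps th |h|
    below 1/2. *)
Lemma chernoff (h : Sigma m1 m2 -> R) r (B e : R) n : fdep r h -> 1 <= B ->
  (forall x, `|h x| <= B) -> expect mu r h = 0 -> 0 < e -> e <= 1 ->
  fine (P [set z | e * n%:R <= hsum h z n]) <= expR (- (e ^+ 2 / (8 * B ^+ 2))) ^+ n.
Proof.
move=> dh B1 hB Eh e0 e1; pose th := e / (4 * B ^+ 2).
have B20 : 0 < B ^+ 2 by rewrite exprn_gt0//; lra.
have th0 : 0 < th by rewrite divr_gt0// mulr_gt0.
have thB : th * B <= 2^-1.
  have -> : th * B = e / (4 * B) by rewrite /th; field; lra.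
  by rewrite ler_pdivrMr; lra.
pose F x := expR (th * h x).
have EF : expect mu r F <= expR (2 * th ^+ 2 * B ^+ 2).
  apply: le_trans (_ : expect mu r (fun x => (1 + 2 * th ^+ 2 * B ^+ 2) + th * h x) <= _).
    apply: le_expect => x; have := hB x; rewrite ler_norml => /andP[l1 l2].
    have le1 : th * h x <= 2^-1 by apply: le_trans thB; rewrite ler_wpM2l// ltW.
    apply: le_trans (expR_quad_le le1) _.
    have : h x ^+ 2 <= B ^+ 2.
      by rewrite -[h x ^+ 2]real_normK ?num_real// lerXn2r ?nnegrE//; lra.
    move=> /(ler_wpM2l (sqr_ge0 th)) hh; rewrite exprMn; lra.
  rewrite expectD expect_cst expectZ Eh mulr0 addr0.
  exact: expR_ge1Dx.
pose M := (n * q ^ r)%N.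
have nM : (n <= M)%N by rewrite leq_pmulr// expn_gt0 q_gt0.
(* The cutoff M = n q^r shows the first r letters of every chain i <= n; the chains starting between
   n and M receive the factor 1. *)
pose G i x := if (i <= n)%N then F x else 1.
have headsE (f : nat -> R) : \prod_(i <- heads q M) (if (i <= n)%N then f i else 1) =
    \prod_(i <- heads q n) f i.
  rewrite -big_mkcond /= /heads !big_filter_cond.
  have nM' : (n.+1 <= M.+1)%N by [].
  rewrite (big_cat_nat _ nM')//= [X in _ * X]big_nat_cond [X in _ * X]big1 ?mulr1.
    rewrite big_nat_cond [RHS]big_nat_cond; apply: eq_bigl => i.
    by rewrite ltnS; case: (leqP i n) => //=; rewrite !andbF.
  by move=> i /and3P[/andP[ni _] _ ii]; rewrite ltnNge ii in ni.
have dA : fdep M [set z | e * n%:R <= hsum h z n].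
  by move=> z w zw /=; rewrite (fdep_hsum dh zw).
rewrite (measure_expect P dA).
apply: le_trans (_ : expect P M (fun z => expR (- (th * (e * n%:R))) *
    \prod_(i <- heads q M) G i (subseq_at q i z)) <= _).
  apply: le_expect => z; rewrite /G headsE expR_sum -expRD -mulr_sumr -/(hsum h z n).
  rewrite /ind; case: asboolP => /= hz; last exact: expR_ge0.
  rewrite -[1%:R]expR0 ler_expR addrC subr_ge0.
  by rewrite ler_wpM2l// ltW.
rewrite expectZ (expect_prod hq hP).
have -> : \prod_(i <- heads q M) expect mu (cnt q i M) (G i) =
    \prod_(i <- heads q n) expect mu r F.
  rewrite -headsE big_seq [RHS]big_seq; apply: eq_bigr => i.
  rewrite mem_heads => /and3P[i0 iM _]; rewrite /G; case: leqP => iI.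
    apply: expect_widen; first by move=> z w zw; rewrite /F (dh _ _ zw).
    by apply: ltnW; rewrite (cntP hq)// leq_mul2r iI orbT.
  by rewrite expect_cst.
have EF0 : 0 <= expect mu r F.
  rewrite -(expect_cst mu r 0); apply: le_expect => x; exact: expR_ge0.
rewrite big_const_seq count_predT iter_mulr_1.
apply: le_trans (_ : expR (- (th * (e * n%:R))) * expR (2 * th ^+ 2 * B ^+ 2) ^+ n <= _).
  rewrite ler_wpM2l ?expR_ge0//.
  apply: le_trans (lerXn2r _ _ _ EF) _; rewrite ?nnegrE ?expR_ge0//.
  apply: ler_weXn2l.
    rewrite -[leLHS]expR0 ler_expR; apply: mulr_ge0; last exact: sqr_ge0.
    by apply: mulr_ge0 => //; exact: sqr_ge0.
  by rewrite -[leqRHS](size_heads hq n) leq_addr.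
rewrite -!expRM_natl -expRD ler_expR /th.
rewrite le_eqVlt; apply/orP; left; apply/eqP; field; lra.
Qed.

Lemma chernoff_ae (h : Sigma m1 m2 -> R) r (B e : R) : fdep r h -> 1 <= B ->
  (forall x, `|h x| <= B) -> expect mu r h = 0 -> 0 < e ->
  almost_surely P (fun z => exists n0, forall n, (n0 <= n)%N -> hsum h z n <= e * n%:R).
Proof.
move=> dh B1 hB Eh e0; wlog e1 : e e0 / e <= 1.
  move=> H; have [e1|e1] := leP e 1; first exact: H.
  apply: almost_surelyS (H 1 ltr01 (lexx _)) => z [n0 hn]; exists n0 => n /hn.
  by move=> /le_trans; apply; rewrite ler_wpM2r// ltW.
pose A n := [set z : SigmaB m1 m2 | e * n%:R <= hsum h z n].
have mA n : measurable (A n).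
  apply: (@measurable_fdep _ _ (n * q ^ r)).
  by move=> z w zw; rewrite /A /= (fdep_hsum dh zw).
pose rho := expR (- (e ^+ 2 / (8 * B ^+ 2))).
have rho1 : rho < 1.
  rewrite -[ltRHS]expR0 ltr_expR oppr_lt0 divr_gt0 ?mulr_gt0 ?exprn_gt0//; lra.
have rho0 : 0 < rho by exact: expR_gt0.
have PA0 : P (lim_sup_set A) = 0%E.
  apply: lim_sup_set_cvg0 => //.
  apply: (@le_lt_trans _ _ ((1 - rho)^-1)%:E); last exact: ltry.
  apply: lime_le; first exact: is_cvg_nneseries.
  apply: nearW => n; apply: (@le_trans _ _ (\sum_(0 <= i < n) (rho ^+ i)%:E)%E).
    apply: lee_sum => i _; have := chernoff i dh B1 hB Eh e0 e1.
    by rewrite -lee_fin -(measure_fineE P (mA i)).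
  rewrite sumEFin lee_fin.
  suff : (1 - rho) * \sum_(0 <= i < n) rho ^+ i <= 1.
    by rewrite -ler_pdivlMl ?subr_gt0// mulr1.
  rewrite big_mkord -opprB mulNr -subrX1 opprB lerBlDr lerDl.
  by rewrite exprn_ge0// ltW.
have : P.-negligible (lim_sup_set A).
  apply/negligibleP => //; apply: bigcap_measurable => // k _.
  by apply: bigcup_measurable => n _; exact: mA.
apply: negligibleS => z /= hz k _.
apply: contrapT => hk; apply: hz; exists k => n kn; rewrite leNgt; apply/negP => lt.
by apply: hk; exists n => //; exact: ltW.
Qed.

(** The one-sided bound is applied to f - E and to E - f; taking e = 1/(k + 1) leaves countably many
    exceptional sets. *)
Lemma lln (f : Sigma m1 m2 -> R) r (C : R) : fdep r f ->
  (forall x, `|f x| <= C) ->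
  almost_surely P (fun z => forall e, 0 < e -> exists n0, forall n, (n0 <= n)%N ->
    `|hsum f z n - expect mu r f * (size (heads q n))%:R| <= e * n%:R).
Proof.
move=> df fC; set E := expect mu r f.
pose B := 1 + C + `|E|.
have C0 : 0 <= C by apply: le_trans (fC (fun=> point)).
have B1 : 1 <= B by rewrite /B; have := normr_ge0 E; lra.
have hs (s : R) : `|s| = 1 -> forall e : R, 0 < e ->
    almost_surely P (fun z => exists n0, forall n, (n0 <= n)%N ->
    hsum (fun x => s * f x + - (s * E)) z n <= e * n%:R).
  move=> s1 e e0; apply: (@chernoff_ae _ r B) => //.
  - by move=> z w zw; rewrite (df _ _ zw).
  - move=> x; apply: le_trans (ler_normD _ _) _.
    by rewrite normrN !normrM s1 !mul1r /B; have := fC x; lra.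
  - by rewrite expectD expect_cst expectZ -/E subrr.
have hsumE s z n : hsum (fun x => s * f x + - (s * E)) z n =
    s * (hsum f z n - E * (size (heads q n))%:R).
  rewrite /hsum big_split /= -mulr_sumr big_const_seq count_predT iter_addr_0.
  by rewrite -mulr_natr; ring.
have h1 k : almost_surely P (fun z => exists n0, forall n, (n0 <= n)%N ->
    `|hsum f z n - E * (size (heads q n))%:R| <= k.+1%:R^-1 * n%:R).
  have k0 : 0 < k.+1%:R^-1 :> R by rewrite invr_gt0.
  have := almost_surelyI (hs 1 (normr1 _) _ k0) (hs (-1) (normrN1 _) _ k0).
  apply: almost_surelyS => z [[n1 H1] [n2 H2]]; exists (maxn n1 n2) => n.
  rewrite geq_max => /andP[a b].
  have := H1 n a; have := H2 n b; rewrite !hsumE mulN1r mul1r => u v.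
  by rewrite ler_norml lerNl u v.
apply: almost_surelyS (almost_surely_foralln h1) => z hz e e0.
have [n0 hn] := hz (Num.truncn e^-1); exists n0 => n /hn /le_trans; apply.
rewrite ler_wpM2r// -[leRHS]invrK lef_pV2 ?posrE ?invr_gt0//.
exact/ltW/truncnS_gt.
Qed.

(** Dropping the head of every chain divides the cutoff by q, so the terms of positive level form a
    sum of the same kind. This drives the induction on the level. *)
Lemma csum_shift (c : Sigma m1 m2 -> nat -> R) z n :
  csum q c z n = hsum (fun x => c x 0%N) z n + csum q (fun x l => c x l.+1) z (n %/ q).
Proof.
rewrite (csum_wide hq _ _ (leq_div n q)) /csum /hsum -big_split /=.
rewrite big_seq [RHS]big_seq; apply: eq_bigr => i.
rewrite mem_heads => /and3P[i0 iM _].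
have := cnt_divn hq n 1 i0; rewrite expn1 subn1 => ->.
have : (0 < cnt q i n)%N by rewrite (cntP hq)// expn0 muln1.
by case: (cnt q i n) => // k _; rewrite big_nat_recl.
Qed.

Lemma csum_le (c : Sigma m1 m2 -> nat -> R) z C n :
  (forall x l, `|c x l| <= C) -> `|csum q c z n| <= C * n%:R.
Proof.
move=> h; elim: n => [|n IH]; first by rewrite csum0 normr0 mulr0.
have [i [l [_ _ ->]]] := csumS hq c z n.
apply: le_trans (ler_normD _ _) _.
by rewrite -natr1 mulrDr mulr1 lerD.
Qed.

Definition has_means (c : Sigma m1 m2 -> nat -> R) z := forall l, exists E,
  forall e, 0 < e -> exists n0, forall n, (n0 <= n)%N ->
    `|hsum (c^~ l) z n - E * (size (heads q n))%:R| <= e * n%:R.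

(* The terms of level l >= K contribute at most C n / q^K. *)
Lemma csum_trunc z C K : forall c, (forall x l, `|c x l| <= C) -> has_means c z ->
  forall e, 0 < e -> exists E n0, forall n, (n0 <= n)%N ->
    `|csum q c z n - E * n%:R| <= (e + C / q%:R ^+ K) * n%:R.
Proof.
elim: K => [|K IH] c hC hc e e0.
  exists 0, 0%N => n _; rewrite mul0r subr0 expr0 invr1 mulr1.
  apply: le_trans (csum_le _ _ hC) _.
  by rewrite ler_wpM2r// lerDr ltW.
have e3 : 0 < e / 3 by rewrite divr_gt0.
have [E' [n1 h1]]   := IH (fun x l => c x l.+1)
  (fun x l => hC x l.+1) (fun l => hc l.+1) _ e3.
have [E0 /(_ _ e3)[n2 h2]] := hc 0%N.
have q0 : 0 < q%:R :> R by rewrite ltr0n.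
pose D := `|E0| + `|E'|.
(* The heads have density (q - 1)/q among the positions; the remaining sum is taken at n / q. *)
exists (E0 * ((q%:R - 1) / q%:R) + E' / q%:R).
exists (maxn (maxn (n1 * q) n2) (Num.truncn (D / (e / 3))).+1) => n.
rewrite !geq_max => /andP[/andP[n1n n2n] n3n].
have {}h1 := h1 (n %/ q)%N (_ : (n1 <= n %/ q)%N); rewrite leq_divRL// in h1.
have {h1} := h1 n1n; have {h2} := h2 n n2n.
have Dn : D <= e / 3 * n%:R.
  rewrite mulrC -ler_pdivrMr//; apply: ltW; apply: lt_le_trans (truncnS_gt _) _.
  by rewrite ler_nat.
have [s1 s2] := size_heads_bounds R hq n.
have a1 : (n %/ q)%:R * q%:R <= n%:R :> R by rewrite -natrM ler_nat leq_divM.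
have a2 : n%:R <= (n %/ q)%:R * q%:R + q%:R :> R.
  rewrite -natrM -natrD ler_nat {1}(divn_eq n q) leq_add2l.
  by rewrite ltnW// ltn_pmod.
rewrite [csum q c z n]csum_shift; move: (csum _ _ _ _) (hsum _ _ _) => u v.
move: s1 s2 a1 a2 Dn; move: (size _)%:R (n %/ q)%:R => s a s1 s2 a1 a2 Dn hv hu.
have n0 : 0 <= n%:R :> R by [].
move: n%:R n0 s1 s2 a1 a2 Dn hv hu => x x0 s1 s2 a1 a2 Dn hv hu.
have b1 : `|a - x / q%:R| <= 1.
  have l1 : a <= x / q%:R by rewrite ler_pdivlMr.
  have l2 : x / q%:R <= a + 1 by rewrite ler_pdivrMr// mulrDl mul1r.
  by rewrite ler_norml; apply/andP; split; lra.
have b2 : `|s - (q%:R - 1) / q%:R * x| <= 1 by rewrite ler_norml; apply/andP; split; lra.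
have -> : v + u - (E0 * ((q%:R - 1) / q%:R) + E' / q%:R) * x =
    (v - E0 * s) + (u - E' * a) + (E0 * (s - (q%:R - 1) / q%:R * x) +
      E' * (a - x / q%:R)) by ring.
have b3 : `|E0 * (s - (q%:R - 1) / q%:R * x) + E' * (a - x / q%:R)| <= D.
  apply: le_trans (ler_normD _ _) _; rewrite !normrM.
  by apply: lerD; rewrite -[leRHS]mulr1 ler_wpM2l.
have qa : (e / 3 + C / q%:R ^+ K) * a <= e / 3 * x + C / q%:R ^+ K.+1 * x.
  have C0 : 0 <= C by apply: le_trans (hC (fun=> point) 0%N).
  apply: le_trans (_ : (e / 3 + C / q%:R ^+ K) * (x / q%:R) <= _).
    rewrite ler_wpM2l ?addr_ge0 ?divr_ge0 ?exprn_ge0//; first exact: ltW.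
    by rewrite ler_pdivlMr.
  rewrite mulrDl lerD//.
    rewrite ler_wpM2l ?(ltW e3)// ler_pdivrMr// ler_peMr// ler1n.
    exact: q_gt0.
  rewrite exprS invfM le_eqVlt; apply/orP; left; apply/eqP; ring.
apply: le_trans (ler_normD _ _) _.
apply: le_trans (lerD (le_trans (ler_normD _ _) (lerD hv (le_trans hu qa))) b3) _.
lra.
Qed.

(** The slope is that of a truncation at a level K with q^K > 2 C / e, hence depends on e. *)
Lemma csum_mean z C c : (forall x l, `|c x l| <= C) -> has_means c z ->
  forall e, 0 < e -> exists E n0, forall n, (n0 <= n)%N ->
    `|csum q c z n - E * n%:R| <= e * n%:R.
Proof.
move=> hC hc e e0; have e2 : 0 < e / 2 by rewrite divr_gt0.
pose K := (Num.truncn (C / (e / 2))).+1.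
have [E [n0 h]] := csum_trunc K hC hc e2; exists E, n0 => n /h /le_trans; apply.
rewrite ler_wpM2r//.
suff : C / q%:R ^+ K <= e / 2 by lra.
have q0 : 0 < q%:R :> R by rewrite ltr0n.
rewrite ler_pdivrMr ?exprn_gt0// mulrC -ler_pdivrMr//.
apply: ltW; apply: lt_le_trans (truncnS_gt _) _.
by rewrite -natrX ler_nat ltnW// ltn_expl.
Qed.

Lemma has_means_ae (c : Sigma m1 m2 -> nat -> R) (r : nat -> nat) C :
  (forall x l, `|c x l| <= C) -> (forall l, fdep (r l) (c^~ l)) ->
  almost_surely P (has_means c).
Proof.
move=> hC dc; apply: almost_surely_foralln => l.
have := @lln (c^~ l) (r l) C (dc l) (fun x => hC x l).
by apply: almost_surelyS => z h; exists (expect mu (r l) (c^~ l)).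
Qed.

End LawOfLargeNumbers.

(** * Almost sure upper bounds for the measure of balls *)

Section AlmostSureDimension.
Variables (R : realType) (q m1 m2 j : nat).
Variables (Omega : set (Sigma m1 m2)) (t : word m1 m2 -> R).
Variables (mu P : probability (SigmaB m1 m2) R).
Hypotheses (hq : (2 <= q)%N) (hm2 : (2 <= m2)%N) (hm : (m2 < m1)%N).
Hypothesis hj : (q ^ j)%:R <= (gamma R m1 m2)^-1 < (q ^ j.+1)%:R.
Hypotheses (hOmega0 : Omega !=set0) (hOmega : closed Omega).
Hypotheses (ht : is_t q j Omega t) (hmu : is_mu q j Omega t mu).
Hypothesis hP : is_P q mu P.
Implicit Types (z w x : Sigma m1 m2).

Let g := gamma R m1 m2.
Let L := Lnat R m1 m2.
Let g_gt0 : 0 < g := gamma_gt0 R hm2 hm.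
Let g_le1 : g <= 1 := gamma_le1 R hm2 hm.
Let LP := LnatP R hm2 hm.
Let q_gt0 : (0 < q)%N. Proof. exact: ltnW. Qed.

(* t is only controlled on the prefixes of Omega; clipping makes the functions
   bounded everywhere without changing them on Omega. *)
Definition clip (C a : R) : R := Num.max (- C) (Num.min C a).

Lemma clip_bound C a : 0 <= C -> `|clip C a| <= C.
Proof.
move=> C0; rewrite ler_norml /clip le_max lexx /= ge_max ge_min lexx /= andbT.
by rewrite -subr_ge0 opprK addr_ge0.
Qed.

Lemma clip_id C a : `|a| <= C -> clip C a = a.
Proof. by rewrite ler_norml => /andP[h1 h2]; rewrite /clip min_r// max_r. Qed.

Lemma csum_mean_ae (c : Sigma m1 m2 -> nat -> R) (r : nat -> nat) C :
  (forall x, Omega x -> forall l, `|c x l| <= C) -> (forall l, fdep (r l) (c^~ l)) ->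
  almost_surely P (fun z => XOmega q Omega z -> forall e, 0 < e ->
    exists E n0, forall n, (n0 <= n)%N -> `|csum q c z n - E * n%:R| <= e * n%:R).
Proof.
move=> hC dc; have C0 : 0 <= C.
  by have [x Ox] := hOmega0; exact: le_trans (hC x Ox 0%N).
have dc' l : fdep (r l) ((fun x l => clip C (c x l))^~ l).
  by move=> z w zw; rewrite (dc l _ _ zw).
have hA := has_means_ae hq hP (fun x l => clip_bound (c x l) C0) dc'.
apply: almost_surelyS hA => z hc Xz e e0.
have [E [n0 h]] := csum_mean hq (fun x l => clip_bound (c x l) C0) hc e0.
exists E, n0 => n /h; congr (`|_ - _| <= _).
rewrite /csum big_seq [RHS]big_seq; apply: eq_bigr => i.
rewrite mem_heads => /and3P[i0 _ qi]; apply: eq_bigr => l _.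
by rewrite clip_id//; apply: hC; exact: Xz.
Qed.

(** [is_P] speaks of cylinders, so Omega is approximated by the clopen sets [On n], which contain it
    and so have full measure for mu. Each of the countably many chains lies almost surely in all of
    them, hence in Omega as Omega is closed. *)
Lemma XOmega_ae : almost_surely P (XOmega q Omega).
Proof.
pose On n := [set x | Omega `&` cylN n x !=set0].
have dOn n : fdep n (On n).
  move=> z w zw; rewrite /On /=; congr (_ `&` _ !=set0).
  by rewrite !cylNE; apply/seteqP; split=> x /= h;
    [exact: agree_trans (agree_sym zw) h|exact: agree_trans zw h].
have mO : measurable (Omega : set (SigmaB m1 m2)).
  by rewrite -(setCK Omega); apply: measurableC; apply: sub_sigma_algebra; rewrite openC.
have muOn n : fine (mu (On n)) = 1.
  have mOn := measurable_fdep (dOn n).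
  apply/eqP; rewrite eq_le; apply/andP; split.
    by rewrite -lee_fin -measure_fineE//; exact: probability_le1.
  have -> : 1 = fine (mu Omega) :> R by rewrite hmu.1.
  apply: le_fine_measure => // x Ox; exists x; split=> //.
  by rewrite cylNE.
have h i n : almost_surely P (fun z => (0 < i)%N -> ~~ (q %| i)%N ->
    On n (subseq_at q i z)).
  have [i0|] := posnP i; first by rewrite i0; exists set0; split => // z /=; case.
  move=> i0; have [qi|qi] := boolP (q %| i)%N.
    by exists set0; split => // z /=; case.
  have dz : fdep (i * q ^ n) [set z | On n (subseq_at q i z)].
    have := @fdep_subseq q hq _ _ _ i (i * q ^ n) (On n) i0 _.
    by apply; apply: fdep_le (dOn n); apply: ltnW; rewrite (cntP hq).
  have mz := measurable_fdep dz.
  exists (~` [set z | On n (subseq_at q i z)]); split.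
  - exact: measurableC.
  - rewrite probability_setC// measure_fineE// (P_chain hq hP i0 qi (dOn n)) muOn.
    by rewrite -EFinB subrr.
  - by move=> z /= hz hz'; apply: hz.
have := almost_surely_foralln (fun i => almost_surely_foralln (h i)).
apply: almost_surelyS => z hz i i0 qi.
by apply: closed_cylN => // n; exact: hz.
Qed.

Lemma ball_log_ae : almost_surely P (fun z => XOmega q Omega z /\
  forall e, 0 < e -> exists n0, forall n, (n0 <= n)%N ->
    `|ball_log q j Omega t z n| <= e * n%:R).
Proof.
have [C hC] := logs_bounded hq hOmega0 ht.
have hT : forall x, Omega x -> forall l, `|tlog j t x l| <= C.
  by move=> x Ox l; have [] := hC x Ox l.
have hX : forall x, Omega x -> forall l, `|xlog j Omega t x l| <= C.
  by move=> x Ox l; have [] := hC x Ox l.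
have hS : forall x, Omega x -> forall l, `|slog q j Omega t x l| <= C.
  by move=> x Ox l; have [] := hC x Ox l.
have wd_fdep k l : fdep (k + l) (@wd m1 m2 k l).
  move=> z w zw; apply: eq_wd; split=> i ik; first by rewrite zw// ltn_addr.
  by rewrite zw.
have dT l : fdep (l.+1 + j) ((@tlog R m1 m2 j t)^~ l).
  by move=> z w zw; rewrite /tlog /tval (wd_fdep _ _ _ _ zw).
have dX l : fdep (l + j.+1) ((@xlog R m1 m2 j Omega t)^~ l).
  by move=> z w zw; rewrite /xlog /xval (wd_fdep _ _ _ _ zw).
have dS l : fdep l.+1 ((@slog R q m1 m2 j Omega t)^~ l).
  move=> z w zw; rewrite /slog /sval (_ : yl l.+1 z = yl l.+1 w)//.
  by apply/eq_in_map => i; rewrite mem_iota => /andP[_ il]; rewrite zw.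
have := almost_surelyI XOmega_ae (almost_surelyI (csum_mean_ae hT dT)
  (almost_surelyI (csum_mean_ae hX dX) (csum_mean_ae hS dS))).
apply: almost_surelyS => z [Xz [kT [kX kS]]]; split=> // e e0.
have {}kT := kT Xz; have {}kX := kX Xz; have {}kS := kS Xz.
have small c Q e' : (0 < Q)%N -> 0 < e' -> (forall e, 0 < e -> exists E n0, forall n,
    (n0 <= n)%N -> `|csum q c z n - E * n%:R| <= e * n%:R) ->
    exists n0, forall n, (n0 <= n)%N -> `|Delta g L Q (csum q c z) n| <= e' * n%:R.
  by move=> Q0 e'0 h; exact: (Delta_small g_gt0 g_le1 LP).
have e4 : 0 < e / 4 by rewrite divr_gt0.
have ge4 : 0 < g * (e / 4) by rewrite mulr_gt0.
have Q1 s : (0 < q ^ s)%N by rewrite expn_gt0 q_gt0.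
have [n1 h1] := small _ _ _ (Q1 j.+1) e4 kT.
have [n2 h2] := small _ _ _ (Q1 j) e4 kX.
have [n3 h3] := small _ _ _ (ltn0Sn 0) ge4 kS.
have [n4 h4] := small _ _ _ q_gt0 ge4 kS.
exists (maxn (maxn n1 n2) (maxn n3 n4)) => n; rewrite !geq_max.
move=> /andP[/andP[/h1 {}h1 /h2 {}h2] /andP[/h3 {}h3 /h4 {}h4]].
have inv (c : R) : `|c| <= g * (e / 4) * n%:R -> `|g^-1 * c| <= e / 4 * n%:R.
  by rewrite -mulrA => h; rewrite normrM gtr0_norm ?invr_gt0// ler_pdivrMl.
move: h1 h2 (inv _ h3) (inv _ h4) => {}h1 {}h2 {}h3 {}h4.
rewrite /ball_log -/g -/L mulN1r mulNr.
apply: le_trans (le_trans (ler_normD _ _) (lerD (ler_normD _ _) (ler_normB _ _))) _.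
rewrite normrN.
by apply: le_trans (lerD (lerD h1 h2) (lerD h3 h4)) _; lra.
Qed.

Lemma ln_m1_gt0 : 0 < ln m1%:R :> R.
Proof. by rewrite ln_gt0// ltr1n (leq_ltn_trans (ltnW hm2) hm). Qed.

Lemma ln_m1_L n : ln m1%:R * n%:R <= ln m2%:R * (L n)%:R :> R.
Proof.
have [_ h] := L_bounds g_gt0 LP n.
rewrite /g /gamma in h; have m1p := ln_m1_gt0.
by rewrite mulrC -ler_pdivlMr// mulrAC.
Qed.

Let D := dimension q j Omega t.

Lemma dimension_ge0 : 0 <= D.
Proof.
rewrite /D /dimension mulr_ge0//; last first.
  by rewrite divr_ge0//; [exact: (ln_t0_ge0 hq hOmega0 ht)|exact/ltW/ln_m2_gt0].
by rewrite divr_ge0// subr_ge0 ler1n q_gt0.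
Qed.

(** The measure is about m2^(- D L(n)), and m2^(L(n)) >= m1^n; the gap D - s absorbs the o(n)
    error. *)
Lemma ball_measure_ae s : s < D -> almost_surely P (fun z => exists n0,
  forall n, (n0 <= n)%N -> (P (Bn R n z) <= (expR (- (s * ln m1%:R * n%:R)))%:E)%E).
Proof.
move=> sD; apply: almost_surelyS ball_log_ae => z [Xz h].
have m1p := ln_m1_gt0; have m2p := ln_m2_gt0 R hm2.
have [|n0 hn] := h ((D - s) * ln m1%:R); first by rewrite mulr_gt0// subr_gt0.
exists n0 => n /hn; rewrite ler_norml => /andP[_ {}hn].
rewrite (ball_measure hq hm2 hm hj hOmega0 hOmega ht hmu hP n Xz).
rewrite lee_fin ler_expR.
have [hs _] := size_heads_bounds R hq (L n).
have t0 := ln_t0_ge0 hq hOmega0 ht.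
have k1 := ler_wpM2r t0 hs.
have k2 := ler_wpM2l dimension_ge0 (ln_m1_L n).
have e : (q%:R - 1) / q%:R * (L n)%:R * ln (t_empty q j Omega t) =
    D * (ln m2%:R * (L n)%:R).
  have mn : ln m2%:R != 0 :> R by rewrite gt_eqF.
  have qn : q%:R != 0 :> R by rewrite pnatr_eq0 -lt0n q_gt0.
  by rewrite /D /dimension; field; rewrite ?qn ?mn.
rewrite e in k1; rewrite -/L; lra.
Qed.

Definition small_balls s n0 : set (Sigma m1 m2) := [set z | forall n, (n0 <= n)%N ->
  (P (Bn R n z) <= (expR (- (s * ln m1%:R * n%:R)))%:E)%E].

Lemma Bn_sym n z w : Bn R n z w -> Bn R n z = Bn R n w.
Proof.
move=> [h1 h2]; apply/seteqP; split=> x [k1 k2]; split=> k kn;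
  by rewrite ?k1 ?k2 ?h1 ?h2.
Qed.

(** The union over n0 has full measure, so one of the sets, on which the bound is uniform, has
    positive measure. Measurability holds because P(B_n(z)) depends on the first L n letters of
    z. *)
Lemma small_balls_pos s : s < D -> exists n0,
  measurable (small_balls s n0 : set (SigmaB m1 m2)) /\
  (0 < P (small_balls s n0))%E.
Proof.
move=> sD.
have mE n0 : measurable (small_balls s n0 : set (SigmaB m1 m2)).
  have -> : small_balls s n0 = \bigcap_(n in [set n | (n0 <= n)%N])
      [set z | (P (Bn R n z) <= (expR (- (s * ln m1%:R * n%:R)))%:E)%E] by [].
  apply: bigcap_measurable; first by exists n0 => /=.
  move=> n _; apply: (@measurable_fdep _ _ (L n)) => z w zw /=.
  rewrite (@Bn_sym n z w)//; split=> k kn; rewrite -zw//.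
  exact: leq_trans kn (L_ge g_le1 LP n).
suff [n0 hn0] : exists n0, P (small_balls s n0) != 0%E.
  by exists n0; split=> //; rewrite lt_def hn0 measure_ge0.
apply: contrapT => h.
have h0 n0 : P (small_balls s n0) = 0%E.
  by apply/eqP/negPn/negP => ?; apply: h; exists n0.
have h1 : P.-negligible (\bigcup_n0 (small_balls s n0) : set (SigmaB m1 m2)).
  by apply: negligible_bigcup => n0; apply/(negligibleP _ (mE n0)); exact: h0.
have h2 : P.-negligible ([set: SigmaB m1 m2]).
  have := negligibleU h1 (ball_measure_ae sD); apply: negligibleS => z _.
  have [[n0 hn]|hz] := pselect (exists n0, forall n, (n0 <= n)%N ->
    (P (Bn R n z) <= (expR (- (s * ln m1%:R * n%:R)))%:E)%E).
    by left; exists n0.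
  by right.
have : P [set: SigmaB m1 m2] = 0%E by exact: measure_negligible measurableT h2.
by rewrite probability_setT => /eqP; rewrite onee_eq0.
Qed.

End AlmostSureDimension.

(** * Hausdorff measures *)

Lemma expR_small (R : realType) (a c : R) : 0 < a -> 0 < c ->
  exists n0, forall n, (n0 <= n)%N -> expR (- (a * n%:R)) <= c.
Proof.
move=> a0 c0; exists (Num.truncn (c^-1 / a)).+1 => n hn.
rewrite expRN -[leRHS]invrK lef_pV2 ?posrE ?expR_gt0 ?invr_gt0//.
apply: le_trans (expR_ge1Dx _).
have : c^-1 / a < n%:R by apply: lt_le_trans (truncnS_gt _) _; rewrite ler_nat.
by rewrite ltr_pdivrMr// mulrC; lra.
Qed.

(** * Diameters of balls and the mass distribution principle *)

Section BallsAndDistance.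
Variables (R : realType) (m1 m2 : nat).
Hypotheses (hm2 : (2 <= m2)%N) (hm : (m2 < m1)%N).
Implicit Types (z w x : Sigma m1 m2).

Let g := gamma R m1 m2.
Let L := Lnat R m1 m2.
Let g_gt0 : 0 < g := gamma_gt0 R hm2 hm.
Let g_le1 : g <= 1 := gamma_le1 R hm2 hm.
Let LP := LnatP R hm2 hm.
Let m1p := ln_m1_gt0 R hm2 hm.
Local Notation dist := (@dist R m1 m2).

Lemma first_pow_le s (D : pred nat) n : 0 < s ->
  first_pow m1 s D <= expR (- (ln m1%:R * n%:R)) :> R <->
  forall k, s * k%:R < n%:R -> ~~ D k.
Proof.
move=> s0; rewrite /first_pow; case: pselect => [exD|nD].
  case: ex_minnP => k Dk hk.
  have m10 : 0 < m1%:R :> R by rewrite ltr0n (leq_ltn_trans _ hm).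
  rewrite powR_expR// mulNr ler_expR lerN2 mulrC ler_pM2r//.
  split=> [nk i si|h].
    apply/negP => /hk ki; have : s * k%:R <= s * i%:R by rewrite ler_wpM2l ?ler_nat// ltW.
    lra.
  by rewrite leNgt; apply/negP => /h; rewrite Dk.
split=> [_ k _|_]; last exact: expR_ge0.
by apply/negP => Dk; apply: nD; exists k.
Qed.

Lemma first_pow_ge0 (s : R) (D : pred nat) : 0 <= first_pow m1 s D.
Proof. by rewrite /first_pow; case: pselect => // ?; exact: powR_ge0. Qed.

Lemma dist_ge0 z w : 0 <= dist z w.
Proof. by rewrite /Defs.dist le_max first_pow_ge0. Qed.

Lemma dist_le z w n : dist z w <= expR (- (ln m1%:R * n%:R)) <-> Bn R n z w.
Proof.
rewrite /Defs.dist ge_max; split.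
  move=> /andP[/(first_pow_le _ _ ltr01) h1 /(first_pow_le _ _ g_gt0) h2].
  split=> k kn.
    have /negPn/eqP -> // : ~~ (z k != w k) by apply: h1; rewrite mul1r ltr_nat.
  by have /negPn/eqP -> // : ~~ ((z k).2 != (w k).2) by apply: h2; rewrite -LP.
move=> [h1 h2]; apply/andP; split.
  apply/first_pow_le => // k; rewrite mul1r ltr_nat => kn; apply/negPn/eqP.
  rewrite [LHS]surjective_pairing [RHS]surjective_pairing h1// h2//.
  exact: leq_trans kn (L_ge g_le1 LP n).
by apply/first_pow_le => // k; rewrite -LP => kn; apply/negPn/eqP; rewrite h2.
Qed.

Lemma Bn_gcyl n z : Bn R n z = gcyl n (L n) z.
Proof.
apply/seteqP; split=> w [h1 h2]; split=> k kn; rewrite ?h2//.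
  rewrite [LHS]surjective_pairing [RHS]surjective_pairing h1// h2//.
  exact: leq_trans kn (L_ge g_le1 LP n).
by rewrite -h1.
Qed.

(** In this ultrametric every point of a ball is a centre, so the diameter is at most the radius. *)
Lemma diam_Bn n z A : A `<=` Bn R n z ->
  (diam dist A <= (expR (- (ln m1%:R * n%:R)))%:E)%E.
Proof.
move=> AB; apply: ge_ereal_sup => _ [a Aa [b Ab <-]].
rewrite lee_fin; apply/dist_le.
by rewrite -(Bn_sym (AB _ Aa)); exact: AB.
Qed.

Lemma diam_ge0 (A : set (Sigma m1 m2)) : A !=set0 -> (0 <= diam dist A)%E.
Proof.
move=> [a Aa]; apply: le_trans (_ : (dist a a)%:E <= _)%E.
  by rewrite lee_fin dist_ge0.
by apply: ereal_sup_ubound; exists a => //; exists a.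
Qed.

Lemma gauge_Bn s n z A : 0 <= s -> A `<=` Bn R n z ->
  (gauge dist s A <= (expR (- (s * ln m1%:R * n%:R)))%:E)%E.
Proof.
move=> s0 AB; rewrite /gauge; case: eqP => [_|/eqP/set0P A0].
  by rewrite lee_fin expR_ge0.
have := diam_Bn AB; have := diam_ge0 A0.
case: (diam dist A) => [r| |]//; rewrite poweR_EFin !lee_fin => r0 rn.
have -> : expR (- (s * ln m1%:R * n%:R)) = expR (- (ln m1%:R * n%:R)) `^ s.
  by rewrite powR_expR ?expR_gt0// expRK; congr expR; ring.
by apply: ge0_ler_powR; rewrite ?nnegrE ?expR_ge0.
Qed.

Lemma gauge_ge0 s (A : set (Sigma m1 m2)) : (0 <= gauge dist s A)%E.
Proof. by rewrite /gauge; case: eqP => // _; exact: poweR_ge0. Qed.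

Variable P : probability (SigmaB m1 m2) R.

(** The constant is m1^s: rounding diam A up to a power of m1 costs at most a factor m1. *)
Lemma gauge_ball s n0 z (A : set (Sigma m1 m2)) : 0 <= s -> A z ->
  (diam dist A <= (expR (- (ln m1%:R * n0%:R)))%:E)%E ->
  small_balls P s n0 z ->
  exists V : set (Sigma m1 m2), [/\ measurable (V : set (SigmaB m1 m2)), A `<=` V &
    (P V <= (expR (s * ln m1%:R))%:E * gauge dist s A)%E].
Proof.
move=> s0 Az dA sz.
(* V is the intersection of all the balls of radius at least diam A, which
   also deals with diam A = 0. *)
pose I := [set n | (n0 <= n)%N /\ (diam dist A <= (expR (- (ln m1%:R * n%:R)))%:E)%E].
pose V := \bigcap_(n in I) Bn R n z.
have mB n : measurable (Bn R n z : set (SigmaB m1 m2)).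
  exact: measurable_fdep (@fdep_Bn R m1 m2 hm2 hm n z).
have In0 : I n0 by split.
have mV : measurable (V : set (SigmaB m1 m2)).
  by apply: bigcap_measurable; first by exists n0.
have VB n : I n -> (P V <= (expR (- (s * ln m1%:R * n%:R)))%:E)%E.
  move=> In; apply: (@le_trans _ _ (P (Bn R n z))); last by apply: sz; case: In.
  by apply: le_measure; rewrite ?inE// => x; exact.
exists V; split=> //.
  move=> x Ax n [_ dn]; apply/dist_le; rewrite -lee_fin; apply: le_trans dn.
  by apply: ereal_sup_ubound; exists z => //; exists x.
have A0 : A !=set0 by exists z.
rewrite /gauge; case: eqP => [e|_]; first by rewrite e in Az.
have := diam_ge0 A0; move: dA VB; rewrite /I /=.
case: (diam dist A) => [r| |]//; rewrite poweR_EFin !lee_fin => rn0 VB r0.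
rewrite -EFinM.
have e1 : 1 <= expR (s * ln m1%:R) :> R.
  by rewrite -[leLHS]expR0 ler_expR mulr_ge0// ltW.
(* When diam A = 0, every n >= n0 belongs to I, so P V = 0 if s > 0; if s = 0 the gauge is 0^0 =
   1. *)
have [r00|rn] := eqVneq r 0.
  have {}VB n : (n0 <= n)%N -> (P V <= (expR (- (s * ln m1%:R * n%:R)))%:E)%E.
    by move=> nn; apply: VB; split=> //; rewrite r00 lee_fin expR_ge0.
  rewrite r00; have [s00|sn] := eqVneq s 0.
    rewrite s00 powRr0 mul0r expR0 mulr1; exact: probability_le1.
  rewrite powR0// mulr0; have sp : 0 < s by rewrite lt_def sn.
  rewrite (measure_fineE P mV) lee_fin leNgt; apply/negP => p0.
  have [n1 h] := @expR_small R (s * ln m1%:R) (fine (P V) / 2)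
    (mulr_gt0 sp m1p) (divr_gt0 p0 (ltr0Sn R 1)).
  have := VB _ (leq_maxl n0 n1); rewrite (measure_fineE P mV) lee_fin.
  have := h _ (leq_maxr n0 n1); lra.
have rp : 0 < r by rewrite lt_def rn.
(* Here r = m1^(-y), so the integer part of y is the largest n with r <= m1^(-n). *)
pose y := - ln r / ln m1%:R.
have ry : ln r = - (ln m1%:R * y).
  by rewrite /y mulrC divfK ?opprK// gt_eqF.
have yn0 : n0%:R <= y.
  rewrite /y ler_pdivlMr// lerNr mulrC -ler_expR lnK// posrE//.
have y0 : 0 <= y by apply: le_trans yn0.
have /andP[l1 l2] := truncn_itv y0.
apply: le_trans (VB (Num.truncn y) _) _.
  split; first by rewrite -ltnS -(ltr_nat R); exact: le_lt_trans yn0 l2.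
  by rewrite lee_fin -[leLHS]lnK ?posrE// ler_expR ry lerN2 ler_pM2l.
rewrite lee_fin powR_expR// -expRD ler_expR ry.
have k : s * ln m1%:R * y <= s * ln m1%:R * ((Num.truncn y)%:R + 1).
  rewrite ler_wpM2l ?mulr_ge0 ?(ltW m1p)//.
  by rewrite natr1 ltW.
lra.
Qed.

Lemma hausdorff_measure_gt0 s n0 (X : set (Sigma m1 m2)) : 0 <= s ->
  measurable (small_balls P s n0 : set (SigmaB m1 m2)) ->
  (0 < P (small_balls P s n0))%E -> almost_surely P X ->
  (0 < hausdorff_measure dist s X)%E.
Proof.
move=> s0 mE PE aX; pose E := small_balls P s n0.
pose c := expR (s * ln m1%:R) : R; have c0 : 0 < c by exact: expR_gt0.
pose dl := expR (- (ln m1%:R * n0%:R)) : R.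
apply: (@lt_le_trans _ _ (hausdorff_pre dist s dl X)); last first.
  by apply: ereal_sup_ubound; exists dl => //=; exact: expR_gt0.
apply: (@lt_le_trans _ _ ((c^-1)%:E * P E)%E).
  by rewrite mule_gt0// lte_fin invr_gt0.
apply: le_ereal_inf_tmp => _ [U [XU dU] <-].
have hV i : exists V : set (Sigma m1 m2), [/\ measurable (V : set (SigmaB m1 m2)),
    (U i `&` E) `<=` V & (P V <= c%:E * gauge dist s (U i))%E].
  have [[z [Uz Ez]]|/set0P/negP/negPn/eqP ->] := pselect (U i `&` E !=set0).
    have [V [mV UV PV]] := gauge_ball s0 Uz (dU i) Ez.
    by exists V; split=> // x [Ux _]; exact: UV.
  exists set0; split=> //; rewrite measure0 mule_ge0 ?gauge_ge0// lee_fin ltW//.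
have [V HV] := choice hV.
have mV i : measurable (V i : set (SigmaB m1 m2)) by have [] := HV i.
pose W := \bigcup_i V i.
have mW : measurable (W : set (SigmaB m1 m2)) by exact: bigcup_measurable.
(* W contains the part of E inside X, and the rest of E is negligible; only the measurable sets E
   and W are compared. *)
have PEW : (P E <= P W)%E.
  have mEW : measurable (E `\` W : set (SigmaB m1 m2)) by exact: measurableD.
  have : P (E `\` W : set (SigmaB m1 m2)) = 0%E.
    apply: measure_negligible => //; move: aX; apply: negligibleS => z [Ez nW] Xz.
    have [i _ Uz] := XU z Xz; apply: nW; exists i => //.
    by have [_ h _] := HV i; apply: h.
  move=> PEW0; apply: (@le_trans _ _ (P (W `|` (E `\` W)))).
    apply: le_measure; rewrite ?inE//; first exact: measurableU.
    by move=> z Ez; have [Wz|Wz] := pselect (W z); [left|right].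
  have : (P (W `|` (E `\` W)) <= P W + P (E `\` W : set (SigmaB m1 m2)))%E.
    exact: measureU2 mW mEW.
  by rewrite PEW0 adde0.
rewrite lee_pdivrMl//; apply: le_trans PEW _.
apply: le_trans (_ : (\sum_(0 <= i <oo) P (V i) <= _)%E).
  exact: measure_sigma_subadditive.
rewrite -nneseriesZl; last by move=> i _; exact: gauge_ge0.
by apply: lee_nneseries => i // _; have [_ _] := HV i.
Qed.

End BallsAndDistance.

Lemma geometric_tail (R : realType) (k : R) n0 M : 0 <= k -> k < 1 ->
  \sum_(0 <= n < M) k ^+ n * (n0 <= n)%:R <= k ^+ n0 / (1 - k).
Proof.
move=> k0 k1; have k1' : 0 < 1 - k by rewrite subr_gt0.
rewrite ler_pdivlMr//.
(* Multiplication by 1 - k makes the sum telescope; the maximum covers M <= n0, where the sum is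
   empty. *)
suff : (\sum_(0 <= n < M) k ^+ n * (n0 <= n)%:R) * (1 - k) <=
    k ^+ n0 - k ^+ (maxn n0 M).
  by move=> /le_trans; apply; rewrite gerBl exprn_ge0.
elim: M => [|M IH]; first by rewrite big_geq// mul0r maxn0 subrr.
rewrite big_nat_recr//= mulrDl; have [nM|Mn] := leqP n0 M.
  rewrite (maxn_idPr nM) in IH; rewrite (maxn_idPr (leqW nM)) exprS mulr1; lra.
rewrite mulr0 mul0r addr0 (maxn_idPl Mn).
by rewrite (maxn_idPl (ltnW Mn)) in IH.
Qed.

(** * Economical coverings and the upper bound for the dimension *)

Section MeasureZero.
Variables (R : realType) (q m1 m2 j : nat).
Variables (Omega : set (Sigma m1 m2)) (t : word m1 m2 -> R).
Variables (mu P : probability (SigmaB m1 m2) R).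
Hypotheses (hq : (2 <= q)%N) (hm2 : (2 <= m2)%N) (hm : (m2 < m1)%N).
Hypothesis hj : (q ^ j)%:R <= (gamma R m1 m2)^-1 < (q ^ j.+1)%:R.
Hypotheses (hOmega0 : Omega !=set0) (hOmega : closed Omega).
Hypotheses (ht : is_t q j Omega t) (hmu : is_mu q j Omega t mu).
Hypothesis hP : is_P q mu P.
Implicit Types (z w x : Sigma m1 m2).

Let g := gamma R m1 m2.
Let L := Lnat R m1 m2.
Let g_gt0 : 0 < g := gamma_gt0 R hm2 hm.
Let g_le1 : g <= 1 := gamma_le1 R hm2 hm.
Let LP := LnatP R hm2 hm.
Let m1p := ln_m1_gt0 R hm2 hm.
Let m2p := ln_m2_gt0 R hm2.
Let D := dimension q j Omega t.
Let X := XOmega q Omega.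
Local Notation dist := (@dist R m1 m2).

(** Sets of equal level are disjoint, so their measures add up to at most 1, and the geometric
    series over the levels from n0 on remains. *)
Lemma weighted_sum_le (U : nat -> set (Sigma m1 m2)) (lev : nat -> nat) (k : R) n0 N :
  0 <= k -> k < 1 -> (forall i, measurable (U i : set (SigmaB m1 m2))) ->
  (forall i z, U i z -> (n0 <= lev i)%N) ->
  (forall i i' z, lev i = lev i' -> U i z -> U i' z -> i = i') ->
  \sum_(0 <= i < N) k ^+ lev i * fine (P (U i)) <= k ^+ n0 / (1 - k).
Proof.
move=> k0 k1 mU hU dU; pose M := (\max_(i < N) lev i).+1.
have eq1 : \sum_(0 <= i < N) k ^+ lev i * fine (P (U i)) =
    \sum_(0 <= n < M) k ^+ n * \sum_(0 <= i < N) (lev i == n)%:R * fine (P (U i)).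
  under [RHS]eq_bigr do rewrite mulr_sumr.
  rewrite exchange_big /=; apply: eq_big_nat => i /andP[_ iN].
  rewrite [RHS](bigD1_seq (lev i)) ?iota_uniq//=; last first.
    by rewrite mem_index_iota /M ltnS (leq_bigmax (Ordinal iN)).
  rewrite eqxx mul1r big1 ?addr0// => n /negbTE.
  by rewrite eq_sym => ->; rewrite mul0r mulr0.
rewrite eq1; apply: le_trans (geometric_tail n0 M k0 k1).
apply: ler_sum => n _; apply: ler_wpM2l; first exact: exprn_ge0.
pose U' i := if lev i == n then U i else set0.
have mU' i : measurable (U' i : set (SigmaB m1 m2)) by rewrite /U'; case: ifP.
have -> : \sum_(0 <= i < N) (lev i == n)%:R * fine (P (U i)) =
    \sum_(0 <= i < N) fine (P (U' i)).
  apply: eq_bigr => i _; rewrite /U'; case: eqP => _; first by rewrite mul1r.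
  by rewrite mul0r measure0.
case: leqP => nn; last first.
  rewrite big1// => i _; rewrite /U'; case: eqP => [e|_]; last by rewrite measure0.
  rewrite (_ : U i = set0) ?measure0//; apply/seteqP; split=> // z /hU.
  by rewrite e leqNgt nn.
have trU : trivIset setT U'.
  move=> i i' _ _ [z []]; rewrite /U'; case: eqP => // e; case: eqP => // e'.
  by apply: dU; rewrite e.
have mW : measurable (\big[setU/set0]_(i < N) U' i : set (SigmaB m1 m2)).
  exact: bigsetU_measurable.
have : (P (\big[setU/set0]_(i < N) U' i) <= 1)%E by exact: probability_le1.
have -> : (P (\big[setU/set0]_(i < N) U' i) = \sum_(i < N) P (U' i))%E.
  exact: measure_bigsetU.
by under eq_bigr do rewrite measure_fineE//; rewrite sumEFin lee_fin big_mkord.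
Qed.

Lemma exists_big_ball D' z n0 : D < D' -> X z -> exists2 n, (n0 <= n)%N &
  ((expR (- (D' * ln m2%:R * (L n)%:R)))%:E <= P (Bn R n z))%E.
Proof.
move=> DD' Xz; apply: contrapT => h.
have := local_dim_le hq hm2 hm hj hOmega0 hOmega ht hmu hP Xz.
apply/negP; rewrite -ltNge; apply: (@lt_le_trans _ _ D'%:E).
  by rewrite lte_fin.
rewrite limn_einf_lim; apply: lime_ge; first exact: is_cvg_einfs.
(* Starting at n0 + 1 makes k, hence L k, positive for the division. *)
exists n0.+1 => // n /= n0n; apply: le_ereal_inf_tmp => _ [k /= nk <-].
have k0 : (0 < k)%N by rewrite (leq_trans _ nk)// (leq_trans _ n0n).
have L0 : 0 < (L k)%:R :> R by rewrite ltr0n (leq_trans k0)// (L_ge g_le1 LP).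
have : ~~ ((expR (- (D' * ln m2%:R * (L k)%:R)))%:E <= P (Bn R k z))%E.
  apply/negP => hk; apply: h; exists k => //.
  exact: leq_trans (leqW _) (leq_trans n0n nk).
rewrite -ltNge (ball_measure hq hm2 hm hj hOmega0 hOmega ht hmu hP k Xz).
rewrite lte_fin ltr_expR => hk; rewrite /logE lne_EFin ?expR_gt0// expRK.
rewrite -EFinM lee_fin ler_pdivlMr// -mulNr ler_pdivlMr//; lra.
Qed.

(** Coverings are sequences of sets, so balls are numbered by the words that determine them: n full
    letters and L n - n second coordinates. *)
Definition code (u : word m1 m2) : nat :=
  @pickle (seq (letter m1 * letter m2) * seq (letter m2))%type u.

(* pickle_inv is injective where it is defined, unlike unpickle. *)
Definition level (i : nat) : nat :=
  oapp (fun u : word m1 m2 => size u.1) 0%N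
    (@pickle_inv (seq (letter m1 * letter m2) * seq (letter m2))%type i).

Lemma level_code u : level (code u) = size u.1.
Proof. by rewrite /level /code pickleK_inv. Qed.

Lemma code_inj : injective code.
Proof. exact: pcan_inj (@pickleK_inv _). Qed.

(* The ball coded by i if its radius is small and its P-measure large, and the
   empty set otherwise. *)
Definition covering (D' : R) (n0 : nat) (i : nat) : set (Sigma m1 m2) :=
  [set z | [/\ (n0 <= level i)%N, i = code (wd (level i) (L (level i) - level i) z) &
    ((expR (- (D' * ln m2%:R * (L (level i))%:R)))%:E <= P (Bn R (level i) z))%E]].

Lemma code_wd n z w :
  code (wd n (L n - n) z) = code (wd n (L n - n) w) <-> Bn R n z w.
Proof.
have nL : (n <= L n)%N := L_ge g_le1 LP n.
rewrite (@Bn_gcyl R m1 m2 hm2 hm); split.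
  move=> /code_inj[/eq_in_map e /eq_in_map f]; split=> i ik.
    by apply: e; rewrite mem_iota.
  have [ik'|ki] := ltnP i n; first by rewrite e// mem_iota.
  by apply/esym/f; rewrite mem_iota ki subnKC.
by move=> h; rewrite (@eq_wd _ _ n (L n - n) z w)// subnKC.
Qed.

Lemma covering_Bn D' n0 i z : covering D' n0 i z ->
  covering D' n0 i = Bn R (level i) z.
Proof.
move=> [h1 h2 h3]; apply/seteqP; split=> w.
  by move=> [_ k2 _]; apply/code_wd; rewrite -h2 -k2.
move=> zw; split=> //; first by rewrite {1}h2; apply/code_wd.
by rewrite -(Bn_sym zw).
Qed.

Lemma measurable_covering D' n0 i :
  measurable (covering D' n0 i : set (SigmaB m1 m2)).
Proof.
have [[z hz]|/set0P/negP/negPn/eqP ->] := pselect (covering D' n0 i !=set0); last by [].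
rewrite (covering_Bn hz); exact: measurable_fdep (@fdep_Bn R m1 m2 hm2 hm _ z).
Qed.

(** Since m1^(-n) <= m2 m2^(- L(n)), the gauge is at most m2^s m2^(-(s - D') L(n)) m2^(- D' L(n)).
    The last factor is at most the measure of the ball by choice of the covering, and L(n) >= n
    makes the middle one geometric in n. *)
Lemma gauge_covering s D' n0 i : 0 <= s -> D' < s ->
  (gauge dist s (covering D' n0 i) <=
   (expR (s * ln m2%:R) * (expR (- ((s - D') * ln m2%:R)) ^+ level i *
     fine (P (covering D' n0 i))))%:E)%E.
Proof.
move=> s0 sD.
have [[z hz]|/set0P/negP/negPn/eqP ->] := pselect (covering D' n0 i !=set0); last first.
  by rewrite /gauge eqxx measure0 !mulr0.
rewrite (covering_Bn hz); set n := level i.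
apply: le_trans (gauge_Bn hm2 hm s0 (@subset_refl _ (Bn R n z))) _.
have mB : measurable (Bn R n z : set (SigmaB m1 m2)).
  exact: measurable_fdep (@fdep_Bn R m1 m2 hm2 hm n z).
have [_ _] := hz; rewrite -/n (measure_fineE P mB) !lee_fin => h.
rewrite mulrA (_ : _ * _ ^+ n =
  expR (s * ln m2%:R - (s - D') * ln m2%:R * n%:R)); last first.
  by rewrite -expRM_natl -expRD; congr expR; ring.
apply: le_trans (_ : expR (s * ln m2%:R - (s - D') * ln m2%:R * n%:R) *
  expR (- (D' * ln m2%:R * (L n)%:R)) <= _); last by rewrite ler_wpM2l ?expR_ge0.
rewrite -expRD ler_expR.
have [h1 _] := L_bounds g_gt0 LP n.
have h2 : ln m2%:R * (L n)%:R <= ln m1%:R * n%:R + ln m2%:R :> R.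
  have := ltW h1; rewrite /g /gamma mulrAC ler_pdivrMr//.
  by rewrite mulrDl divfK ?gt_eqF// (mulrC n%:R).
have h3 : n%:R <= (L n)%:R :> R by rewrite ler_nat (L_ge g_le1 LP).
have k1 := ler_wpM2l s0 h2.
have sD0 : 0 <= (s - D') * ln m2%:R by rewrite mulr_ge0 ?subr_ge0// ltW.
have k2 := ler_wpM2l sD0 h3.
lra.
Qed.

Lemma hausdorff_measure_eq0 s : D < s -> hausdorff_measure dist s X = 0%E.
Proof.
move=> Ds; have s0 : 0 <= s.
  by apply: le_trans (ltW Ds); exact: dimension_ge0.
(* D < D' provides arbitrarily small balls of large measure at every point, and D' < s the geometric
   decay. *)
pose D' := (D + s) / 2.
have DD' : D < D' by rewrite /D'; lra.
have D's : D' < s by rewrite /D'; lra.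
pose a := (s - D') * ln m2%:R; pose k := expR (- a) : R.
have a0 : 0 < a by rewrite mulr_gt0// subr_gt0.
have k0 : 0 < k by exact: expR_gt0.
have k1 : k < 1 by rewrite -[ltRHS]expR0 ltr_expR oppr_lt0.
have k1' : 0 < 1 - k by rewrite subr_gt0.
have pre_ge0 dl : (0 <= hausdorff_pre dist s dl X)%E.
  apply: le_ereal_inf_tmp => _ [U _ <-]; apply: nneseries_ge0 => i _ _.
  exact: gauge_ge0.
apply/eqP; rewrite eq_le; apply/andP; split; last first.
  apply: le_trans (pre_ge0 1) _; apply: ereal_sup_ubound.
  by exists 1 => //=.
apply: ge_ereal_sup => _ [dl /= dl0 <-]; apply/lee_addgt0Pr => e e0; rewrite add0e.
pose K := expR (s * ln m2%:R) : R; have K0 : 0 < K by exact: expR_gt0.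
have [n1 h1] := expR_small m1p dl0.
have [n2 h2] := expR_small a0 (divr_gt0 (mulr_gt0 e0 k1') K0).
pose n0 := maxn n1 n2; pose U := covering D' n0.
apply: (@le_trans _ _ (\sum_(0 <= i <oo) gauge dist s (U i))%E).
  apply: ereal_inf_lbound; exists U => //; split.
    move=> z Xz; have [n nn h] := exists_big_ball n0 DD' Xz.
    exists (code (wd n (L n - n) z)) => //.
    by rewrite /U /covering /= level_code size_map size_iota.
  move=> i; have [[z hz]|/set0P/negP/negPn/eqP ->] := pselect (U i !=set0).
    have hU : U i = Bn R (level i) z := covering_Bn hz.
    apply: le_trans (diam_Bn hm2 hm (z := z) (n := level i) _) _; first by rewrite hU.
    rewrite lee_fin; apply: h1; have [hn _ _] := hz.
    by apply: leq_trans hn; exact: leq_maxl.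
  by apply: ge_ereal_sup => _ [x []].
apply: lime_le; first by apply: is_cvg_nneseries => i _ _; exact: gauge_ge0.
apply: nearW => N.
apply: (@le_trans _ _ (\sum_(0 <= i < N) (K * (k ^+ level i * fine (P (U i))))%:E)%E).
  by apply: lee_sum => i _; exact: gauge_covering.
rewrite sumEFin lee_fin -mulr_sumr -ler_pdivlMl//.
apply: (@le_trans _ _ (k ^+ n0 / (1 - k))).
  apply: weighted_sum_le => //; first exact: ltW.
  - by move=> i; exact: measurable_covering.
  - by move=> i z [].
  - by move=> i i' z ei [_ -> _] [_ -> _]; rewrite ei.
have -> : k ^+ n0 = expR (- (a * n0%:R)).
  by rewrite /k -expRM_natl; congr expR; ring.
rewrite ler_pdivrMr//; apply: le_trans (h2 n0 (leq_maxr _ _)) _.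
by rewrite mulrC mulrA.
Qed.

End MeasureZero.

Theorem theorem2p8 (R : realType) (q m1 m2 j : nat)
    (Omega : set (Sigma m1 m2)) (t : word m1 m2 -> R)
    (mu P : probability (SigmaB m1 m2) R)
    (hq : (2 <= q)%N) (hm2 : (2 <= m2)%N) (hm : (m2 < m1)%N)
    (hj : (q ^ j)%:R <= (gamma R m1 m2)^-1 < (q ^ j.+1)%:R)
    (hOmega0 : Omega !=set0) (hOmega : closed Omega)
    (ht : is_t q j Omega t) (hmu : is_mu q j Omega t mu) (hP : is_P q mu P) :
  (forall z : Sigma m1 m2, XOmega q Omega z ->
    (limn_einf (fun n => - logE m2 (P (Bn R n z))
                         * ((Lnat R m1 m2 n)%:R^-1)%:E)
     <= ((q%:R - 1) / q%:R * (ln (t_empty q j Omega t) / ln m2%:R))%:E)%E) /\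
  hausdorff_dim (@dist R m1 m2) (XOmega q Omega)
    = ((q%:R - 1) / q%:R * (ln (t_empty q j Omega t) / ln m2%:R))%:E.

Proof.
split=> [z Xz|].
  exact: (local_dim_le hq hm2 hm hj hOmega0 hOmega ht hmu hP Xz).
rewrite -/(dimension q j Omega t); apply/eqP; rewrite eq_le; apply/andP; split.
  (* The infimum is approached through exponents above the dimension, since the measure at the
     critical exponent need not vanish. *)
  apply/lee_addgt0Pr => e e0; rewrite -EFinD; apply: ereal_inf_lbound.
  exists (dimension q j Omega t + e) => //; split.
    by apply: addr_ge0; [exact: (dimension_ge0 hq hm2 hOmega0 ht)|exact: ltW].
  apply: (hausdorff_measure_eq0 hq hm2 hm hj hOmega0 hOmega ht hmu hP).
  by rewrite ltrDl.
apply: le_ereal_inf_tmp => _ [s [s0 Hs] <-]; rewrite lee_fin leNgt; apply/negP => sD.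
have [n0 [mE PE]] := small_balls_pos hq hm2 hm hj hOmega0 hOmega ht hmu hP sD.
have := hausdorff_measure_gt0 hm2 hm s0 mE PE (XOmega_ae hq hOmega hmu hP).
by rewrite Hs ltxx.
Qed.
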